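(* Let $(a_n:n\in\mathbb N_0)\subseteq(0,\infty)$ be a lacunary sequence, i.e. $a:=\inf_{n\in\mathbb N_0}\frac{a_{n+1}}{a_n}>1$. Then for every $p\in(1,\infty]$ there exists a constant $C_p>0$ such that for every $d\in\mathbb N$ and every $f\in\ell^p(\mathbb Z^d)$ $$\Big\|\sup_{n\in\mathbb N_0}|\mathcal M_{a_n}^Qf|\Big\|_{\ell^p(\mathbb Z^d)}\le C_p\|f\|_{\ell^p(\mathbb Z^d)}.$$ The constant $C_p$ may also depend on the quantity $a$ corresponding to the lacunary sequence.
   Context: $\mathbb N_0=\{0,1,2,\ldots\}$. For $t>0$ let $Q_t=[-t,t]^d$ and $Q=Q_1=[-1,1]^d$. For $f:\mathbb Z^d\to\mathbb C$ and $x\in\mathbb Z^d$, $$\mathcal M_t^Qf(x)=\frac{1}{|Q_t\cap\mathbb Z^d|}\sum_{y\in Q_t\cap\mathbb Z^d}f(x-y),$$ where $|Q_t\cap\mathbb Z^d|=(2\lfloor t\rfloor+1)^d$ is the number of lattice points in $Q_t$. *)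

(* Defs.v *)
From HB Require Import structures.
From mathcomp Require Import all_boot all_order all_algebra.
From mathcomp Require Import all_classical all_reals all_analysis.
From mathcomp Require Import finmap complex.

Set Implicit Arguments.
Unset Strict Implicit.
Unset Printing Implicit Defensive.

Import Order.TTheory GRing.Theory Num.Theory.
Import numFieldNormedType.Exports.

Local Open Scope classical_set_scope.
Local Open Scope ring_scope.

(* A copy of 'rV[int]_d, so as to carry the discrete sigma-algebra. *)
Definition lattice (d : nat) : Type := 'rV[int]_d.

HB.instance Definition _ (d : nat) := GRing.Zmodule.on (lattice d).
HB.instance Definition _ (d : nat) := isPointed.Build (lattice d) 0.
HB.instance Definition _ (d : nat) :=
  @isMeasurable.Build default_measure_display (lattice d)
    (@discrete_measurable (lattice d))
    (@discrete_measurable0 (lattice d))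
    (@discrete_measurableC (lattice d))
    (@discrete_measurableU (lattice d)).

Definition lattice_cube (R : realType) (d : nat) (t : R) : set (lattice d) :=
  [set y | forall i : 'I_d, - t <= ((y : 'rV[int]_d) ord0 i)%:~R <= t].

Arguments lattice_cube {R} d t.

(* So the fset_set (and the sum) in cube_average is never the junk value that
   it takes on infinite sets. *)
Lemma finite_lattice_cube (R : realType) (d : nat) (t : R) :
  finite_set (lattice_cube d t).
Proof.
pose N := Num.truncn `|t|.
pose h (g : {ffun 'I_d -> 'I_(N + N).+1}) : lattice d :=
  \row_i ((g i)%:Z - N%:Z).
apply: (@sub_finite_set _ _ (range h)); last exact/finite_image/finite_finset.
move=> y /= yt.
have yN (i : 'I_d) : (`|(y : 'rV[int]_d) ord0 i| <= N)%N.
  rewrite /N truncn_ge_nat// natr_absz intr_norm.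
  by rewrite (le_trans _ (ler_norm t))// ler_norml.
exists [ffun i => inord (absz ((y : 'rV[int]_d) ord0 i + N%:Z))] => //.
apply/rowP => i; rewrite !mxE ffunE.
have := yN i; set k := (y : 'rV[int]_d) ord0 i => kN.
have [kl ku] : (0 <= k + N%:Z) /\ k + N%:Z <= (N + N)%N%:Z.
  have: `|k| <= N%:Z by rewrite -abszE lez_nat.
  rewrite ler_norml => /andP[k1 k2]; split.
    by rewrite -lerBlDr sub0r.
  by rewrite PoszD lerD2r.
by rewrite inordK ?gez0_abs ?addrK// ltnS -lez_nat gez0_abs.
Qed.

Definition cube_average (R : realType) (d : nat) (t : R)
    (f : lattice d -> R[i]) (x : lattice d) : R[i] :=
  (#|` fset_set (lattice_cube d t) |%:R)^-1
    * \sum_(y \in lattice_cube d t) f (x - y).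

(* The l^p norm of F on Z^d, as the L^p norm for the counting measure. Its only
   null set being empty, at p = +oo it is the pointwise supremum of |F|. *)
Definition lpnorm (R : realType) (d : nat) (p : \bar R)
    (F : lattice d -> \bar R) : \bar R :=
  ('N[@counting (lattice d) R]_p[F])%E.

Definition cmod (R : realType) (d : nat) (f : lattice d -> R[i]) :
    lattice d -> \bar R :=
  fun x => (ComplexField.Normc.normc (f x))%:E.

Definition sup_cube_averages (R : realType) (d : nat) (a_ : nat -> R)
    (f : lattice d -> R[i]) (x : lattice d) : \bar R :=
  ereal_sup (range (fun n => cmod (cube_average (a_ n) f) x)).

Definition lacunary_ratio (R : realType) (a_ : nat -> R) : R :=
  inf (range (fun n => a_ n.+1 / a_ n)).

(* Main.v *)
From HB Require Import structures.
Require Import Defs.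
From mathcomp Require Import all_boot all_order all_algebra.
From mathcomp Require Import all_classical all_reals all_analysis.
From mathcomp Require Import ess_sup_inf finmap complex.
From mathcomp Require Import ring lra zify.

Set Implicit Arguments.
Unset Strict Implicit.
Unset Printing Implicit Defensive.

Import Order.TTheory GRing.Theory Num.Theory.

Local Open Scope ring_scope.

(** The constant must not see the dimension, so the proof compares the cube
    averages A_n, with one side length in each dyadic block [2^n, 2^(n+1)), with
    averages P_n whose theory is dimension free for structural reasons. Averaging
    over the cells of the grid of cubes of side 2^n is a conditional expectation;
    for varying n these form a martingale, for which Doob's maximal inequality
    ([doob_maximal]) and, for exponents between 1 and 2, the square function
    estimate ([condexp_square_function]) hold with constants that depend on the
    exponent only. The average over all translates of the grid is a convolution
    operator P_n, the convolution with a product of triangle functions, and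
    convexity passes both estimates on to it ([dyadic_weight_maximal],
    [dyadic_weight_square_function]).

    The comparison rests on orthogonality. The symbols of A_n and P_n are products
    of one-dimensional symbols, and the bounds of [fejer_decay] and [fejer_small]
    are stable under products: with s the sum of the |1 - z_i|^2 over the
    coordinates, both symbols are within O(4^n s) of 1 and decay at infinity in
    terms of 4^n s, with absolute constants. So the symbol of
    (A_n - P_n)(P_j - P_(j+1)) is exponentially small in |n - j|, and because the
    symbols of the P_j - P_(j+1) are nonnegative with a sum at most 1, the part at
    distance k = |n - j| of the square function is O(2^(-k)) on L^2
    ([square_at_l2]).

    Since A_n - P_n annihilates constants, A_n f - P_n f is the sum over j of
    (A_n - P_n)(P_j - P_(j+1)) f, and the supremum of the A_n f is at most that of
    the P_n f plus the square function of the A_n f - P_n f. Geometric decay in k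
    on L^p of the parts at distance k therefore implies the maximal inequality on
    L^p ([square_decay_maximal]). This settles p = 2. For p < 2 one bootstraps: a
    maximal inequality at the exponent p0 implies a vector-valued inequality at q,
    with 1/q = (1 + 1/p0) / 2 ([conv_square_sum]), hence a bound on L^q without
    decay for the parts at distance k ([square_at_bound]); interpolation with L^2
    ([marcinkiewicz]) restores the decay for every exponent between q and 2.
    Iterating reaches every p > 1 ([cube_maximal]).

    All this takes place on the tori (Z/2^(J+1))^d, where only finite sums occur.
    Finitely many averages at finitely many points of the lattice see only a
    bounded box, which embeds in a large torus ([box_maximal_finite]); monotone
    convergence does the rest. Finally, in a lacunary sequence of ratio a at most c
    terms fall into each dyadic block as soon as a^c >= 2, so that c sequences with
    one term in each block cover it ([lacunary_classes]). For p = +oo an average is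
    bounded by the supremum. *)

(** * Inequalities between real powers *)
Section PowerInequalities.
Variable R : realType.
Implicit Types a b p t u v w M : R.

Lemma powR_amgm t u v : 0 < t < 1 -> 0 <= u -> 0 <= v ->
  u `^ t * v `^ (1 - t) <= t * u + (1 - t) * v.
Proof.
move=> /andP[t0 t1] u0 v0.
have s0 : 0 < 1 - t by rewrite subr_gt0.
have h := @conjugate_powR R (u `^ t) (v `^ (1 - t)) t^-1 (1 - t)^-1
  (powR_ge0 _ _) (powR_ge0 _ _).
rewrite !invr_gt0 !invrK in h.
have := h t0 s0 (subrKC _ _).
by rewrite -!powRrM !mulfV ?gt_eqF// !powRr1// [u * t]mulrC [v * _]mulrC.
Qed.

(** Convexity of the p-th power, as weighted arithmetic-geometric mean applied to
    v ^ p and w ^ p with weights 1 / p and 1 - 1 / p. *)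
Lemma powR_tangent p v w : 1 < p -> 0 <= v -> 0 <= w ->
  w `^ p + p * w `^ (p - 1) * (v - w) <= v `^ p.
Proof.
move=> p1 v0 w0.
have p0 : 0 < p by rewrite (lt_trans _ p1).
have wp : w `^ (p - 1) * w = w `^ p by rewrite mulrC mulr_powRB1.
have h := @powR_amgm p^-1 (v `^ p) (w `^ p).
have ip : 0 < p^-1 < 1 by rewrite invr_gt0 p0 invf_lt1.
have := h ip (powR_ge0 _ _) (powR_ge0 _ _).
rewrite -!powRrM mulfV ?gt_eqF// powRr1//.
rewrite mulrBr mulr1 mulfV ?gt_eqF// => {}h.
have := ler_wpM2l (ltW p0) h.
rewrite (_ : p * (p^-1 * _ + _) = v `^ p + (p - 1) * w `^ p); last first.
  by field; rewrite gt_eqF.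
by rewrite mulrBr -[_ * w]mulrA wp; lra.
Qed.

Lemma powR_concave_tangent t v w : 0 < t < 1 -> 0 <= v -> 0 < w ->
  t * w `^ (t - 1) * (w - v) <= w `^ t - v `^ t.
Proof.
move=> t01 v0 w0; have /andP[t0 t1] := t01.
have wt : w `^ (t - 1) * w = w `^ t by rewrite mulrC mulr_powRB1// ltW.
have h := powR_amgm t01 v0 (ltW w0).
have := ler_wpM2l (powR_ge0 w (t - 1)) h.
rewrite mulrCA -powRD; last by rewrite (gt_eqF w0) implybT.
rewrite addrA subrK subrr powRr0 mulr1.
by move: wt; set X := w `^ (t - 1) => wt; nra.
Qed.

(** Applying the tangent inequality twice, at the midpoint of [v, w] and at w,
    leaves a difference of first derivatives, which the concavity of the
    derivative bounds from below. *)
Lemma powR_tangent_quad p v w M : 1 < p < 2 -> 0 <= v <= M -> 0 <= w <= M ->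
  0 < M ->
  p * (p - 1) / 4 * M `^ (p - 2) * (v - w) ^+ 2 <=
    v `^ p - (w `^ p + p * w `^ (p - 1) * (v - w)).
Proof.
move=> /andP[p1 p2] /andP[v0 vM] /andP[w0 wM] M0.
have p0 : 0 < p by rewrite (lt_trans _ p1).
pose m := (v + w) / 2.
have m0 : 0 <= m by rewrite /m; lra.
have mM : m <= M by rewrite /m; lra.
have h1 := powR_tangent p1 v0 m0.
have h2 := powR_tangent p1 m0 w0.
have t01 : 0 < p - 1 < 1 by rewrite subr_gt0 p1/=; lra.
have key u z : 0 <= z <= u -> 0 < u -> u <= M ->
    (p - 1) * M `^ (p - 2) * (u - z) <= u `^ (p - 1) - z `^ (p - 1).
  move=> /andP[z0 zu] u0 uM.
  apply: le_trans (powR_concave_tangent t01 z0 u0).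
  rewrite ler_wpM2r ?subr_ge0// ler_wpM2l//; first lra.
  rewrite (_ : p - 1 - 1 = - (2 - p)); last lra.
  rewrite (_ : p - 2 = - (2 - p)); last lra.
  rewrite !powRN lef_pV2 ?posrE ?powR_gt0//.
  by rewrite ge0_ler_powR ?nnegrE ?(ltW u0) ?(ltW M0)//; lra.
have [vw|vw|vw] := ltgtP v w.
- have := key w m; rewrite /m in h1 h2 *.
  move=> /(_ _ _ wM)/= => h3.
  have {}h3 := h3 (ltac:(apply/andP; split; lra)) (ltac:(lra)).
  set X := M `^ _ in h3 *; set Y := w `^ (p - 1) in h2 h3 *.
  set Z := (_ / 2) `^ (p - 1) in h1 h3; set T := (_ / 2) `^ p in h1 h2.
  have := ler_wpM2l (ltac:(nra) : 0 <= p * (w - v) / 2) h3; nra.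
- have := key m w; rewrite /m in h1 h2 mM *.
  move=> /(_ _ _ mM)/= => h3.
  have {}h3 := h3 (ltac:(apply/andP; split; lra)) (ltac:(lra)).
  set X := M `^ _ in h3 *; set Y := w `^ (p - 1) in h2 h3 *.
  set Z := (_ / 2) `^ (p - 1) in h1 h3; set T := (_ / 2) `^ p in h1 h2.
  have := ler_wpM2l (ltac:(nra) : 0 <= p * (v - w) / 2) h3; nra.
- by rewrite vw !subrr expr0n/= !mulr0 addr0 subrr.
Qed.

Lemma powR_le u v t : 0 <= t -> 0 <= u -> u <= v -> u `^ t <= v `^ t.
Proof.
by move=> t0 u0 uv; rewrite ge0_ler_powR// nnegrE// (le_trans u0).
Qed.

Lemma powR_subadd t u v : 0 < t <= 1 -> 0 <= u -> 0 <= v ->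
  (u + v) `^ t <= u `^ t + v `^ t.
Proof.
move=> /andP[t0 t1] u0 v0.
have [uv0|uv0] := eqVneq (u + v) 0.
  by rewrite uv0 powR0 ?gt_eqF// addr_ge0 ?powR_ge0.
have uvgt : 0 < u + v by rewrite lt_def uv0 addr_ge0.
have key w : 0 <= w <= u + v -> w * (u + v) `^ (t - 1) <= w `^ t.
  move=> /andP[w0 wuv]; have [->|wn0] := eqVneq w 0.
    by rewrite mul0r powR_ge0.
  have wgt : 0 < w by rewrite lt_def wn0.
  rewrite -(mulr_powRB1 w0 t0) ler_wpM2l//.
  rewrite -opprB !powRN lef_pV2 ?posrE ?powR_gt0//.
  by rewrite powR_le ?subr_ge0.
rewrite -(mulr_powRB1 (ltW uvgt) t0) mulrDl lerD// key// ?u0 ?v0/=.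
  by rewrite lerDl.
by rewrite lerDr.
Qed.

Lemma powR_sum_le (I : Type) (r : seq I) (P : pred I) (F : I -> R) t :
  0 < t <= 1 -> (forall i, 0 <= F i) ->
  (\sum_(i <- r | P i) F i) `^ t <= \sum_(i <- r | P i) F i `^ t.
Proof.
move=> t01 F0; elim: r => [|i r IH].
  by rewrite !big_nil powR0 ?gt_eqF//; case/andP: t01.
rewrite !big_cons; case: ifP => // _.
by apply: (le_trans (powR_subadd t01 (F0 i) _)); rewrite ?lerD2l ?sumr_ge0.
Qed.

Lemma powR_addX p u v : 0 <= p -> 0 <= u -> 0 <= v ->
  (u + v) `^ p <= 2 `^ p * (u `^ p + v `^ p).
Proof.
move=> p0; wlog uv : u v / u <= v => [hw u0 v0|u0 v0].
  have [uv|/ltW vu] := leP u v; first exact: hw.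
  by rewrite addrC [u `^ p + _]addrC; exact: hw.
apply: (@le_trans _ _ ((2 * v) `^ p)).
  by rewrite powR_le ?addr_ge0//; lra.
by rewrite powRM// ler_wpM2l ?powR_ge0// lerDr powR_ge0.
Qed.

(** Young's inequality with a small coefficient, without optimising the other
    one: if K u <= v / 2 the left-hand side is at most v ^ p / 2, otherwise
    v < 2 K u. *)
Lemma powR_young_half p K u v : 1 < p -> 0 <= K -> 0 <= u -> 0 <= v ->
  K * u * v `^ (p - 1) <= v `^ p / 2 + (2 * K) `^ p * u `^ p.
Proof.
move=> p1 K0 u0 v0; have p0 : 0 < p by lra.
have Ku0 : 0 <= K * u by rewrite mulr_ge0.
have [h|h] := leP (2 * K * u) v.
  apply: (@le_trans _ _ (v `^ p / 2)); last first.
    by rewrite lerDl mulr_ge0 ?powR_ge0// mulr_ge0.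
  rewrite -(mulr_powRB1 v0 p0) [leRHS]mulrAC ler_wpM2r ?powR_ge0//.
  by rewrite ler_pdivlMr// mulrC mulrA.
apply: (@le_trans _ _ ((2 * K) `^ p * u `^ p)); last first.
  by rewrite lerDr mulr_ge0 ?powR_ge0.
rewrite -powRM ?mulr_ge0// -(mulr_powRB1 _ p0) ?mulr_ge0//.
rewrite ler_pM ?powR_ge0//; first by rewrite -mulrA ler_peMl// ler1n.
by apply: powR_le => //; [rewrite subr_ge0 ltW|exact: ltW].
Qed.

(** Hoelder's inequality for the exponents 2 / q and 2 / (2 - q), in the
    additive form that suffices when both factors are controlled by the same
    quantity. *)
Lemma powR_half_mul q u v : 1 < q < 2 -> 0 <= u -> 0 <= v ->
  (u * v) `^ (q / 2) <= v + u `^ (q / (2 - q)).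
Proof.
move=> /andP[q1 q2] u0 v0.
have t01 : 0 < q / 2 < 1 by apply/andP; split; lra.
rewrite powRM//.
have := powR_amgm t01 v0 (powR_ge0 u (q / (2 - q))).
rewrite -powRrM (_ : q / (2 - q) * (1 - q / 2) = q / 2); last first.
  by field; lra.
rewrite mulrC => /le_trans; apply; apply: lerD.
  rewrite ler_piMl//; lra.
rewrite ler_piMl ?powR_ge0//; lra.
Qed.

End PowerInequalities.

(** * Conditional expectations over finite partitions *)
Section BigMax.
Variable R : realType.

Lemma bigmax_ge0 n (F : nat -> R) : 0 <= \big[Num.max/0]_(j < n) F j.
Proof. by elim/big_rec: _ => // i x _ x0; rewrite le_max x0 orbT. Qed.

Lemma bigmax_leP n (F : nat -> R) M : 0 <= M ->
  (forall j, (j < n)%N -> F j <= M) -> \big[Num.max/0]_(j < n) F j <= M.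
Proof.
by move=> M0 FM; apply: bigmax_le => // -[j jn] _ /=; exact: FM.
Qed.

Lemma le_bigmax_nat n (F : nat -> R) j : (j < n)%N ->
  F j <= \big[Num.max/0]_(i < n) F i.
Proof. by move=> jn; exact: (le_bigmax _ (F \o val) (Ordinal jn)). Qed.

End BigMax.

Lemma sum_diff (V : zmodType) n (u : nat -> V) :
  \sum_(j < n) (u j - u j.+1) = u 0 - u n.
Proof.
elim: n => [|n IH]; first by rewrite big_ord0 subrr.
by rewrite big_ord_recr/= IH addrA subrK.
Qed.

Section ConditionalExpectation.
Variables (R : realType) (T : finType) (K : eqType).
Implicit Types (c : T -> K) (f h : T -> R).

Definition condexp c f (x : T) : R :=
  (\sum_(y | c y == c x) f y) / #|[pred y | c y == c x]|%:R.

Definition cells_constant c h := forall x y, c x = c y -> h x = h y.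

Lemma condexp_cells_constant c f : cells_constant c (condexp c f).
Proof. by move=> x y cxy; rewrite /condexp cxy. Qed.

Lemma condexp_ge0 c f x : (forall y, 0 <= f y) -> 0 <= condexp c f x.
Proof. by move=> f0; rewrite divr_ge0// sumr_ge0. Qed.

Lemma sum_condexp_mul c f h : cells_constant c h ->
  \sum_x condexp c f x * h x = \sum_x f x * h x.
Proof.
move=> ch; rewrite /condexp.
under eq_bigr do rewrite mulr_suml mulr_suml big_mkcond/=.
rewrite exchange_big/=; apply: eq_bigr => y _.
rewrite (eq_bigr (fun x => if c x == c y then
    f y * h y / #|[pred z | c z == c y]|%:R else 0)); last first.
  move=> x _; rewrite eq_sym; case: eqP => // cxy.
  by rewrite cxy (ch _ _ cxy) mulrAC.
rewrite -big_mkcond sumr_const -[LHS]mulr_natr; apply: divfK.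
rewrite pnatr_eq0 -lt0n; apply/card_gt0P; exists y.
by rewrite !inE.
Qed.

Lemma condexp_powR_le c f p : 1 < p -> (forall x, 0 <= f x) ->
  \sum_x condexp c f x `^ p <= \sum_x f x `^ p.
Proof.
move=> p1 f0.
rewrite -subr_ge0 -sumrB.
apply: (@le_trans _ _ (\sum_x p * (f x * condexp c f x `^ (p - 1) -
  condexp c f x * condexp c f x `^ (p - 1)))).
  rewrite -mulr_sumr sumrB sum_condexp_mul ?subrr ?mulr0//.
  by move=> x y /(condexp_cells_constant f) ->.
apply: ler_sum => x _.
have := powR_tangent p1 (f0 x) (condexp_ge0 c x f0); lra.
Qed.

Variables (c : nat -> T -> K).
Hypothesis c_coarser : forall n x y, c n x = c n y -> c n.+1 x = c n.+1 y.

Local Notation E := (fun n => condexp (c n)).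
Local Notation Emax f k n x := (\big[Num.max/0]_(j < k) condexp (c (n + j)) f x).

Lemma condexp_max_cells_constant f k n :
  cells_constant (c n) (fun x => Emax f k n x).
Proof.
move=> x y cxy; apply: eq_bigr => -[j _] _ /=; apply: condexp_cells_constant.
by elim: j => [|j IH]; rewrite ?addn0// addnS; exact: c_coarser.
Qed.

Let EmaxS f k n x : Emax f k.+1 n x = Num.max (E n f x) (Emax f k n.+1 x).
Proof.
rewrite big_ord_recl addn0; congr (Num.max _ _).
by apply: eq_bigr => j _; rewrite addSnnS.
Qed.

(** Passing to a finer partition, the maximal function changes only at the
    points where its new value is that of the new average, which may then be
    replaced by f because both maximal functions are constant on its cells. *)
Lemma doob_maximal_self p f k n : 1 < p -> (forall x, 0 <= f x) ->
  \sum_x Emax f k n x `^ p <=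
    p / (p - 1) * \sum_x f x * Emax f k n x `^ (p - 1).
Proof.
move=> p1 f0; have p10 : 0 < p - 1 by rewrite subr_gt0.
have p0 : 0 < p by rewrite (lt_trans _ p1).
elim: k n => [n|k IH n].
  rewrite big1 => [|x _]; last by rewrite big_ord0 powR0// gt_eqF.
  apply: mulr_ge0; first by rewrite divr_ge0// ltW.
  by apply: sumr_ge0 => x _; rewrite mulr_ge0 ?powR_ge0.
have mc1 : cells_constant (c n) (fun x => Emax f k.+1 n x `^ (p - 1)).
  by move=> x y /(condexp_max_cells_constant f k.+1) ->.
have mc2 : cells_constant (c n) (fun x => Emax f k n.+1 x `^ (p - 1)).
  by move=> x y /c_coarser /(condexp_max_cells_constant f k) ->.
have key : \sum_x (Emax f k.+1 n x `^ p - Emax f k n.+1 x `^ p) <=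
    \sum_x p / (p - 1) * (E n f x * Emax f k.+1 n x `^ (p - 1) -
      E n f x * Emax f k n.+1 x `^ (p - 1)).
  apply: ler_sum => x _; rewrite EmaxS.
  set a := E n f x; set b := Emax f k n.+1 x.
  have a0 : 0 <= a by exact: condexp_ge0.
  have b0 : 0 <= b by exact: (bigmax_ge0 _ (fun j => condexp (c (n.+1 + j)) f x)).
  have [ab|/ltW ba] := leP a b; first by rewrite !subrr mulr0.
  have := powR_tangent p1 a0 b0.
  rewrite -(mulr_powRB1 a0 p0) -(mulr_powRB1 b0 p0) => h.
  rewrite [p / _ * _]mulrAC ler_pdivlMr//; lra.
move: key; rewrite -mulr_sumr !sumrB !sum_condexp_mul// mulrBr.
have := IH n.+1; lra.
Qed.

(** Young's inequality absorbs half of the left-hand side, in place of the usual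
    Hoelder inequality followed by a division. *)
Lemma doob_maximal p f k : 1 < p -> (forall x, 0 <= f x) ->
  \sum_x (\big[Num.max/0]_(j < k) E j f x) `^ p <=
    2 * (2 * (p / (p - 1))) `^ p * \sum_x f x `^ p.
Proof.
move=> p1 f0; have := doob_maximal_self k 0 p1 f0.
have K0 : 0 <= p / (p - 1) by rewrite divr_ge0//; lra.
set L := p / _ in K0 *.
have : L * \sum_x f x * Emax f k 0 x `^ (p - 1) <=
    \sum_x (Emax f k 0 x `^ p / 2 + (2 * L) `^ p * f x `^ p).
  rewrite mulr_sumr; apply: ler_sum => x _; rewrite mulrA.
  by apply: powR_young_half => //;
    exact: (bigmax_ge0 _ (fun j => condexp (c (0 + j)) f x)).
rewrite big_split/= -mulr_suml -mulr_sumr.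
lra.
Qed.

(** The convexity gaps of the p-th power along the sequence of averages telescope,
    and each of them dominates a square weighted by a power of the maximal
    function. *)
Lemma condexp_square_function q f J : 1 < q < 2 -> (forall x, 0 <= f x) ->
  \sum_x (\big[Num.max/0]_(j < J.+1) E j f x) `^ (q - 2) *
      (\sum_(n < J) (E n f x - E n.+1 f x) ^+ 2) <=
    4 / (q * (q - 1)) * \sum_x f x `^ q.
Proof.
move=> q12 f0; have /andP[q1 q2] := q12.
pose M x := \big[Num.max/0]_(j < J.+1) E j f x.
have q0 : 0 < q by rewrite (lt_trans _ q1).
have a0 : 0 < q * (q - 1) by rewrite mulr_gt0// subr_gt0.
rewrite -ler_pdivrMl ?divr_gt0// invf_div.
under eq_bigr do rewrite mulr_sumr.
rewrite exchange_big mulr_sumr/=.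
apply: (@le_trans _ _ (\sum_(n < J) (\sum_x E n f x `^ q -
    \sum_x E n.+1 f x `^ q))); last first.
  rewrite (sum_diff _ (fun n => \sum_x E n f x `^ q)).
  rewrite (le_trans _ (condexp_powR_le (c 0) q1 f0))// gerBl sumr_ge0// => x _.
  exact: powR_ge0.
apply: ler_sum => -[n nJ] _ /=.
have <- : \sum_x (E n f x `^ q - (E n.+1 f x `^ q + q * E n.+1 f x `^ (q - 1) *
    (E n f x - E n.+1 f x))) = \sum_x E n f x `^ q - \sum_x E n.+1 f x `^ q.
  rewrite sumrB big_split/= [X in _ - (_ + X)](_ : _ = 0) ?addr0//.
  have cc : cells_constant (c n.+1) (fun x => E n.+1 f x `^ (q - 1)).
    by move=> x y /(condexp_cells_constant f) ->.
  rewrite (eq_bigr (fun x => q * (E n f x * E n.+1 f x `^ (q - 1) -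
      E n.+1 f x * E n.+1 f x `^ (q - 1)))) => [|x _]; last by ring.
  rewrite -mulr_sumr sumrB !sum_condexp_mul// ?subrr ?mulr0//.
  by move=> x y /c_coarser /cc.
rewrite mulr_sumr; apply: ler_sum => x _.
have En0 m : 0 <= E m f x by exact: condexp_ge0.
have EM m : (m < J.+1)%N -> E m f x <= M x.
  by move=> mJ; exact: (le_bigmax_nat (fun j => E j f x)).
have := EM n (ltnW nJ); have := EM n.+1 nJ; rewrite -/(M x).
have [->|M0] := eqVneq (M x) 0.
  move=> h1 h2.
  rewrite (le_anti (introT andP (conj h1 (En0 _)))).
  rewrite (le_anti (introT andP (conj h2 (En0 _)))).
  by rewrite !subrr expr0n/= !mulr0 addr0 subrr.
move=> h1 h2; rewrite mulrA; apply: powR_tangent_quad; rewrite ?En0//.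
by rewrite lt_def M0 (le_trans (En0 n)).
Qed.

End ConditionalExpectation.

(** * Convolution with probability weights *)
Section CauchySchwarz.
Variables (R : realType) (I : Type).

Lemma sum_mul_sqr_le (r : seq I) (a b : I -> R) :
  (\sum_(i <- r) a i * b i) ^+ 2 <=
    (\sum_(i <- r) a i ^+ 2) * (\sum_(i <- r) b i ^+ 2).
Proof.
have h : 0 <= \sum_(i <- r) \sum_(j <- r) (a i * b j - a j * b i) ^+ 2.
  by apply: sumr_ge0 => i _; apply: sumr_ge0 => j _; exact: sqr_ge0.
have e : \sum_(i <- r) \sum_(j <- r) (a i * b j - a j * b i) ^+ 2 =
    ((\sum_(i <- r) a i ^+ 2) * (\sum_(i <- r) b i ^+ 2) -
     (\sum_(i <- r) a i * b i) ^+ 2) *+ 2.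
  rewrite (eq_bigr (fun i => a i ^+ 2 * (\sum_(j <- r) b j ^+ 2) +
     (b i ^+ 2 * (\sum_(j <- r) a j ^+ 2) -
      2 * (a i * b i) * (\sum_(j <- r) a j * b j)))) => [|i _]; last first.
    rewrite !mulr_sumr -sumrB -big_split/=; apply: eq_bigr => j _; ring.
  rewrite big_split/= sumrB -!mulr_suml -mulr_sumr; ring.
rewrite -subr_ge0; move: h; rewrite e; lra.
Qed.

End CauchySchwarz.

Section WeightedSums.
Variables (R : realType) (I : finType) (w : I -> R).
Hypothesis w0 : forall i, 0 <= w i.
Implicit Types F H : I -> R.

Lemma wsum_cauchy_schwarz F H :
  (\sum_i w i * (F i * H i)) ^+ 2 <=
    (\sum_i w i * F i ^+ 2) * (\sum_i w i * H i ^+ 2).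
Proof.
have := sum_mul_sqr_le (index_enum I) (fun i => Num.sqrt (w i) * F i)
  (fun i => Num.sqrt (w i) * H i).
have e (F1 F2 : I -> R) : \sum_i Num.sqrt (w i) * F1 i * (Num.sqrt (w i) * F2 i)
    = \sum_i w i * (F1 i * F2 i).
  by apply: eq_bigr => i _; rewrite mulrACA -expr2 sqr_sqrtr.
rewrite e => /le_trans; apply.
by rewrite (eq_bigr _ (fun i _ => expr2 _)) e
  [X in _ * X](eq_bigr _ (fun i _ => expr2 _)) e.
Qed.

(** The tangent to the p-th power at the mean lies below the power, and its
    weighted sum is the p-th power of the mean. *)
Lemma wsum_jensen p F : \sum_i w i = 1 -> 1 < p -> (forall i, 0 <= F i) ->
  (\sum_i w i * F i) `^ p <= \sum_i w i * F i `^ p.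
Proof.
move=> w1 p1 F0; set m := \sum_i _.
have m0 : 0 <= m by apply: sumr_ge0 => i _; rewrite mulr_ge0.
apply: (@le_trans _ _ (\sum_i w i * (m `^ p + p * m `^ (p - 1) * (F i - m)))).
  rewrite (eq_bigr (fun i => w i * (m `^ p - p * m `^ (p - 1) * m) +
      p * m `^ (p - 1) * (w i * F i))) => [|i _]; last by ring.
  by rewrite big_split/= -mulr_suml -mulr_sumr w1 -/m mul1r subrK.
by apply: ler_sum => i _; rewrite ler_wpM2l// powR_tangent.
Qed.

End WeightedSums.

Section Convolution.
Variables (R : realType) (G : finZmodType).
Implicit Types (w f g h : G -> R).

Definition conv w f (x : G) : R := \sum_y w y * f (x - y).

Definition prob_weight w := (forall y, 0 <= w y) /\ \sum_y w y = 1.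

Lemma convD w f g x : conv w (fun y => f y + g y) x = conv w f x + conv w g x.
Proof. by rewrite -big_split; apply: eq_bigr => y _; rewrite mulrDr. Qed.

Lemma convB w f g x : conv w (fun y => f y - g y) x = conv w f x - conv w g x.
Proof. by rewrite -sumrB; apply: eq_bigr => y _; rewrite mulrBr. Qed.

Lemma conv_sumr (I : Type) (r : seq I) (P : pred I) w (f : I -> G -> R) x :
  conv w (fun y => \sum_(i <- r | P i) f i y) x =
  \sum_(i <- r | P i) conv w (f i) x.
Proof.
rewrite exchange_big/=; apply: eq_bigr => y _.
by rewrite mulr_sumr.
Qed.

Lemma convBl w1 w2 f x :
  conv (fun y => w1 y - w2 y) f x = conv w1 f x - conv w2 f x.
Proof. by rewrite -sumrB; apply: eq_bigr => y _; rewrite mulrBl. Qed.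

Lemma eq_conv w f g x : f =1 g -> conv w f x = conv w g x.
Proof. by move=> fg; apply: eq_bigr => y _; rewrite fg. Qed.

Lemma sum_conv w f : \sum_x conv w f x = (\sum_y w y) * \sum_x f x.
Proof.
rewrite exchange_big/= mulr_suml; apply: eq_bigr => y _.
rewrite -mulr_sumr; congr (_ * _).
by rewrite (reindex_inj (addIr y))/=; apply: eq_bigr => x _; rewrite addrK.
Qed.

Section Positive.
Variable w : G -> R.
Hypothesis pw : prob_weight w.

Let w0 y : 0 <= w y. Proof. by case: pw. Qed.

Lemma sum_conv_prob f : \sum_x conv w f x = \sum_x f x.
Proof. by rewrite sum_conv; case: pw => _ ->; rewrite mul1r. Qed.

Lemma conv_ge0 f x : (forall y, 0 <= f y) -> 0 <= conv w f x.
Proof. by move=> f0; apply: sumr_ge0 => y _; rewrite mulr_ge0. Qed.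

Lemma conv_le f g x : (forall y, f y <= g y) -> conv w f x <= conv w g x.
Proof. by move=> fg; apply: ler_sum => y _; rewrite ler_wpM2l. Qed.

Lemma conv_cst (t : R) x : conv w (fun=> t) x = t.
Proof. by rewrite /conv -mulr_suml; case: pw => _ ->; rewrite mul1r. Qed.

Lemma conv_cauchy_schwarz f g x :
  (conv w (fun y => f y * g y) x) ^+ 2 <=
    conv w (fun y => f y ^+ 2) x * conv w (fun y => g y ^+ 2) x.
Proof. exact: (wsum_cauchy_schwarz w0). Qed.

Lemma conv_jensen p f x : 1 < p -> (forall y, 0 <= f y) ->
  conv w f x `^ p <= conv w (fun y => f y `^ p) x.
Proof.
by move=> p1 f0; apply: (wsum_jensen w0 (proj2 pw) p1) => y; exact: f0.
Qed.

End Positive.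

(** Splitting |g i| into |g i| S^(-t/2) and S^(t/2), with S the sum of the
    squares, the first factor is summed in L^1 and the second is left to the
    maximal operator. *)
Lemma conv_square_sum q C (I : finType) (w : I -> G -> R)
    (U : (G -> R) -> G -> R) (g : I -> G -> R) :
  1 < q < 2 -> (forall i, prob_weight (w i)) ->
  (forall f x, 0 <= U f x) ->
  (forall i f x, (forall y, 0 <= f y) -> conv (w i) f x <= U f x) ->
  (forall f, (forall y, 0 <= f y) ->
    \sum_x U f x `^ (q / (2 - q)) <= C * \sum_x f x `^ (q / (2 - q))) ->
  \sum_x (\sum_i conv (w i) (g i) x ^+ 2) `^ (q / 2) <=
    (1 + C) * \sum_x (\sum_i g i x ^+ 2) `^ (q / 2).
Proof.
move=> q12 pw U0 wU UC; have /andP[q1 q2] := q12.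
pose S x := \sum_i g i x ^+ 2.
have S0 x : 0 <= S x by apply: sumr_ge0 => i _; exact: sqr_ge0.
pose t := 1 - q / 2.
have t0 : 0 < t by rewrite /t; lra.
have gS i x : S x = 0 -> g i x = 0.
  move=> /eqP; rewrite psumr_eq0 => [/allP/(_ i (mem_index_enum _))|j _].
    by rewrite sqrf_eq0 => /eqP.
  exact: sqr_ge0.
pose V x := \sum_i conv (w i) (fun y => g i y ^+ 2 * S y `^ (- t)) x.
pose W x := U (fun y => S y `^ t) x.
have W0 x : 0 <= W x by exact: U0.
have V0 x : 0 <= V x.
  apply: sumr_ge0 => i _; apply: conv_ge0 => // y.
  by rewrite mulr_ge0 ?sqr_ge0 ?powR_ge0.
have key i x : conv (w i) (g i) x ^+ 2 <=
    W x * conv (w i) (fun y => g i y ^+ 2 * S y `^ (- t)) x.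
  have := conv_cauchy_schwarz (pw i) (fun y => g i y * S y `^ (- t / 2))
    (fun y => S y `^ (t / 2)) x.
  rewrite (@eq_conv _ _ (g i)) => [/le_trans->//|y].
    rewrite mulrC ler_pM//.
    - by apply: conv_ge0 => // y; exact: sqr_ge0.
    - by apply: conv_ge0 => // y; exact: sqr_ge0.
    - apply: le_trans (wU i _ _ (fun y => powR_ge0 _ _)).
      apply: conv_le => // y.
      by rewrite -powR_mulrn ?powR_ge0// -powRrM divfK.
    - apply: conv_le => // y.
      by rewrite exprMn ler_wpM2l ?sqr_ge0// -powR_mulrn ?powR_ge0// -powRrM divfK.
  have [Sy|Sy] := eqVneq (S y) 0; first by rewrite gS// !mul0r.
  rewrite -mulrA -powRD ?Sy ?implybT//.
  by rewrite mulNr addNr powRr0 mulr1.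
apply: (@le_trans _ _ (\sum_x (V x + W x `^ (q / (2 - q))))).
  apply: ler_sum => x _; apply: le_trans (powR_half_mul q12 (W0 x) (V0 x)).
  apply: powR_le; [lra|by apply: sumr_ge0 => i _; exact: sqr_ge0|].
  by rewrite mulr_sumr; apply: ler_sum.
rewrite big_split/= mulrDl mul1r lerD//.
  rewrite exchange_big/=; under eq_bigr do rewrite (sum_conv_prob (pw _)).
  rewrite exchange_big/=; apply: ler_sum => x _.
  rewrite -mulr_suml -/(S x).
  have [->|Sx] := eqVneq (S x) 0; first by rewrite mul0r powR_ge0.
  rewrite -[X in X * _]powRr1// -powRD ?Sx ?implybT//.
  by rewrite (_ : 1 - t = q / 2)// /t; lra.
apply: (le_trans (UC _ _)) => [y|]; first exact: powR_ge0.
rewrite le_eqVlt; apply/orP; left; apply/eqP; congr (_ * _).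
apply: eq_bigr => x _; rewrite -powRrM /t; congr (_ `^ _); field.
by rewrite gt_eqF// subr_gt0.
Qed.

End Convolution.

(** * Marcinkiewicz interpolation *)
Section GeometricSums.
Variable R : realType.

Lemma powR_gt1 (t u : R) : 0 < t -> 1 < u -> 1 < u `^ t.
Proof.
move=> t0 u1; have := gt0_ltr_powR t0 _ _ u1; rewrite powR1.
by apply; rewrite nnegrE// ltW// (lt_trans ltr01).
Qed.

Lemma powRV (t u : R) : 0 <= u -> u^-1 `^ t = (u `^ t)^-1.
Proof. by move=> u0; rewrite -powR_inv1// -powRrM mulN1r powRN. Qed.

(** Only the largest term that is at most Y matters; here it is the last one. *)
Lemma geometric_sum_le_up (r u Y : R) n : 1 < r -> 0 <= u -> 0 <= Y ->
  \sum_(i < n | u * r ^+ i <= Y) u * r ^+ i <= r / (r - 1) * Y.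
Proof.
move=> r1 u0 Y0; have r10 : 0 < r - 1 by rewrite subr_gt0.
have full m : \sum_(i < m) u * r ^+ i <= u * r ^+ m / (r - 1).
  elim: m => [|m IH].
    by rewrite big_ord0 divr_ge0 ?mulr_ge0 ?exprn_ge0// ltW// (lt_trans ltr01).
  rewrite big_ord_recr/= (le_trans (lerD IH (lexx _)))// exprS.
  rewrite le_eqVlt; apply/orP; left; apply/eqP; field.
  by rewrite gt_eqF.
elim: n => [|n IH].
  by rewrite big_ord0 mulr_ge0// divr_ge0 ?(ltW r10)// ltW// (lt_trans ltr01).
rewrite big_mkcond big_ord_recr -big_mkcond/=; case: ifPn => [h|_]; last first.
  by rewrite addr0.
apply: (@le_trans _ _ (\sum_(i < n.+1) u * r ^+ i)).
  rewrite big_ord_recr/= lerD2r [leRHS](bigID (fun i : 'I_n => u * r ^+ i <= Y))/=.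
  rewrite lerDl sumr_ge0// => i _.
  by rewrite mulr_ge0 ?exprn_ge0// ltW// (lt_trans ltr01).
apply: (le_trans (full _)); rewrite exprS [leRHS]mulrAC.
rewrite ler_wpM2r ?invr_ge0 ?(ltW r10)// mulrCA ler_wpM2l// ltW//.
by rewrite (lt_trans ltr01).
Qed.

(** The mirror image: the largest term that is at most Y is the first one. *)
Lemma geometric_sum_le_down (r u Y : R) n : 0 < r < 1 -> 0 <= u -> 0 <= Y ->
  \sum_(i < n | u * r ^+ i <= Y) u * r ^+ i <= Y / (1 - r).
Proof.
move=> /andP[r0 r1] u0 Y0; have r10 : 0 < 1 - r by rewrite subr_gt0.
have full m v : 0 <= v -> \sum_(i < m) v * r ^+ i <= v / (1 - r).
  elim: m v => [|m IH] v v0; first by rewrite big_ord0 divr_ge0 ?(ltW r10).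
  rewrite big_ord_recl/= expr0 mulr1.
  rewrite (eq_bigr (fun i : 'I_m => (v * r) * r ^+ i)) => [|i _]; last first.
    by rewrite /bump/= add1n exprS mulrA.
  have := IH (v * r) (mulr_ge0 v0 (ltW r0)) => {}IH.
  apply: (le_trans (lerD (lexx _) IH)).
  rewrite le_eqVlt; apply/orP; left; apply/eqP; field.
  by rewrite gt_eqF.
elim: n u u0 => [|n IH] u u0.
  by rewrite big_ord0 divr_ge0 ?(ltW r10).
rewrite big_mkcond big_ord_recl -big_mkcond/= expr0 mulr1; case: ifPn => [h|_].
  apply: (@le_trans _ _ (\sum_(i < n.+1) u * r ^+ i)).
    rewrite big_ord_recl/= expr0 mulr1 lerD2l.
    rewrite [leRHS](bigID (fun i : 'I_n => u * r ^+ bump 0 i <= Y))/=.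
    by rewrite lerDl sumr_ge0// => i _; rewrite mulr_ge0 ?exprn_ge0// ltW.
  by apply: (le_trans (full _ _ u0)); rewrite ler_wpM2r ?invr_ge0 ?(ltW r10).
rewrite add0r; apply: le_trans (IH (u * r) (mulr_ge0 u0 (ltW r0))).
rewrite le_eqVlt; apply/orP; left; apply/eqP.
by apply: eq_big => i; rewrite /bump/= add1n exprS mulrA.
Qed.

End GeometricSums.

Section Interpolation.
Variable R : realType.

(** Marcinkiewicz interpolation. At each dyadic height the function is cut at
    gam times that height; the free parameter gam is what lets a small constant
    at the exponent 2 survive at p. *)
Lemma marcinkiewicz (q p : R) : 1 < q -> q < p -> p < 2 ->
  exists2 K : R, 0 < K & forall (X : finType) (T :
    (X -> R) -> X -> R) (B e gam : R),
    0 <= B -> 0 <= e -> 0 < gam ->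
    (forall f x, 0 <= T f x) ->
    (forall f g x, T (fun y => f y + g y) x <= 2 * (T f x + T g x)) ->
    (forall f : X -> R, (forall x, 0 <= f x) ->
       \sum_x T f x `^ q <= B * \sum_x f x `^ q) ->
    (forall f : X -> R, (forall x, 0 <= f x) ->
       \sum_x T f x ^+ 2 <= e * \sum_x f x ^+ 2) ->
    forall f : X -> R, (forall x, 0 <= f x) ->
      \sum_x T f x `^ p <=
        K * (B * gam `^ (q - p) + e * gam `^ (2 - p)) * \sum_x f x `^ p.
Proof.
move=> q1 qp p2.
pose r1 : R := 2 `^ (p - q). pose r2 : R := 2 `^ (p - 2).
have r11 : 1 < r1 by apply: powR_gt1; rewrite ?subr_gt0// ltr1n.
have r10 : 0 < r1 := lt_trans ltr01 r11.
have r21 : 0 < r2 < 1.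
  rewrite powR_gt0//= /r2 -opprB powRN invf_lt1 ?powR_gt0//.
  by apply: powR_gt1; rewrite ?subr_gt0// ltr1n.
pose K1 := 2 `^ (p - q) * 4 `^ q * (r1 / (r1 - 1)).
pose K2 := 16 / (1 - r2).
have K10 : 0 < K1 by rewrite !mulr_gt0 ?powR_gt0 ?invr_gt0 ?subr_gt0//
  (lt_trans ltr01).
have K20 : 0 < K2 by rewrite divr_gt0// subr_gt0; case/andP: r21.
exists (K1 + K2); first by rewrite addr_gt0.
move=> X T B e gam B0 e0 gam0 T0 TD Tq T2 f f0.
have [eta eta0 etaT] : exists2 eta : R, 0 < eta &
    forall x, 0 < T f x -> eta < T f x.
  pose m := \big[Num.min/1]_(x | 0 < T f x) T f x.
  have m0 : 0 < m by rewrite /m; elim/big_ind: _ => // a b a0 b0; rewrite lt_min a0.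
  exists (m / 2) => [|x Tx]; first by rewrite divr_gt0.
  rewrite (lt_le_trans (_ : m / 2 < m)) ?(bigmin_le_cond _ _)//.
  by rewrite gtr_pMr// invf_lt1// ltr1n.
have [n Tn] : exists n : nat, forall x, T f x <= eta * 2 ^+ n.
  have S0 : 0 <= (\sum_x T f x) / eta by rewrite divr_ge0 ?sumr_ge0 ?(ltW eta0).
  exists (Num.bound ((\sum_x T f x) / eta)) => x.
  apply: (@le_trans _ _ (\sum_x T f x)).
    by rewrite (bigD1 x)//= lerDl sumr_ge0.
  rewrite mulrC -ler_pdivrMr// (le_trans (ltW (archi_boundP S0)))//.
  by rewrite -natrX ler_nat ltnW// ltn_expl.
pose lam (i : nat) := eta * 2 ^+ i.
have lam0 i : 0 < lam i by rewrite mulr_gt0 ?exprn_gt0.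
pose hi i x := if gam * lam i < f x then f x else 0.
pose lo i x := if gam * lam i < f x then 0 else f x.
have hi0 i x : 0 <= hi i x by rewrite /hi; case: ifP.
have lo0 i x : 0 <= lo i x by rewrite /lo; case: ifP.
have hilo i x : hi i x + lo i x = f x.
  by rewrite /hi /lo; case: ifP; rewrite ?addr0 ?add0r.
have lamX i t : lam i `^ t = eta `^ t * (2 `^ t) ^+ i.
  rewrite /lam powRM ?exprn_ge0 ?(ltW eta0)//; congr (_ * _).
  by rewrite -[2 ^+ i]powR_mulrn// powRAC powR_mulrn ?powR_ge0.
have p0 : 0 < p by lra.
have q0 : 0 < q by lra.
have step1 x : T f x `^ p <= \sum_(i < n)
    (2 `^ (p - q) * 4 `^ q * lam i `^ (p - q) * T (hi i) x `^ q +
     16 * lam i `^ (p - 2) * T (lo i) x ^+ 2).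
  have sum0 : forall i : 'I_n, 0 <= 
    (2 `^ (p - q) * 4 `^ q * lam i `^ (p - q) * T (hi i) x `^ q +
     16 * lam i `^ (p - 2) * T (lo i) x ^+ 2).
    by move=> i; rewrite addr_ge0// !mulr_ge0 ?powR_ge0 ?sqr_ge0.
  have [Tf0|Tf0] := eqVneq (T f x) 0.
    by rewrite Tf0 powR0 ?gt_eqF// sumr_ge0.
  have Tfgt : 0 < T f x by rewrite lt_def Tf0 T0.
  have [i [il iu]] : exists i : 'I_n, lam i < T f x /\ T f x <= 2 * lam i.
    have ex : exists m, T f x <= lam m by exists n; exact: Tn.
    case: (ex_minnP ex) => -[|m] Tm mmin.
      by move: Tm; rewrite /lam expr0 mulr1 leNgt etaT.
    have mn : (m < n)%N by exact: (mmin n (Tn x)).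
    exists (Ordinal mn) => /=; split; last first.
      by move: Tm; rewrite /lam exprS mulrCA.
    rewrite ltNge; apply/negP => /mmin; by rewrite ltnn.
  rewrite (bigD1 i)//= -[leLHS]addr0 lerD ?sumr_ge0//.
  have Tle : T f x <= 2 * (T (hi i) x + T (lo i) x).
    rewrite (_ : f = fun y => hi i y + lo i y); first exact: TD.
    by apply/funext => y; rewrite hilo.
  set a := T (hi i) x in Tle *; set b := T (lo i) x in Tle *.
  have a0 : 0 <= a by exact: T0. have b0 : 0 <= b by exact: T0.
  have [ba|ab] := leP b a.
    rewrite -[leLHS]addr0 lerD ?mulr_ge0 ?powR_ge0 ?sqr_ge0//.
    rewrite (_ : T f x `^ p = T f x `^ (p - q) * T f x `^ q); last first.
      by rewrite -powRD ?Tf0 ?implybT// subrK.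
    rewrite (mulrAC _ (4 `^ q)) -!powRM ?(ltW (lam0 _))// -mulrA -powRM//.
    by rewrite ler_pM ?powR_ge0//; apply: powR_le => //; lra.
  rewrite -[leLHS]add0r lerD ?mulr_ge0 ?powR_ge0//.
  rewrite (_ : T f x `^ p = T f x `^ (p - 2) * T f x ^+ 2); last first.
    by rewrite -powR_mulrn// -powRD ?Tf0 ?implybT// subrK.
  rewrite [leRHS]mulrAC [leRHS]mulrC ler_pM ?powR_ge0 ?sqr_ge0//.
    rewrite -opprB !powRN lef_pV2 ?posrE ?powR_gt0//.
    by apply: powR_le; [lra|exact: ltW (lam0 i)|exact: ltW].
  rewrite (_ : 16 = 4 ^+ 2); last by rewrite -natrX.
  rewrite -exprMn ler_pXn2r ?nnegrE ?mulr_ge0//; lra.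
apply: (le_trans (ler_sum _ (fun x _ => step1 x))).
rewrite exchange_big/=.
apply: (@le_trans _ _ (\sum_(i < n)
   (2 `^ (p - q) * 4 `^ q * B * (lam i `^ (p - q) * \sum_x hi i x `^ q) +
     16 * e * (lam i `^ (p - 2) * \sum_x lo i x ^+ 2)))).
  apply: ler_sum => i _; rewrite big_split/= -!mulr_sumr lerD//.
    rewrite -!mulrA !ler_wpM2l ?powR_ge0//.
    by rewrite mulrCA ler_wpM2l ?powR_ge0// Tq.
  rewrite -!mulrA !ler_wpM2l//.
  by rewrite mulrCA ler_wpM2l ?powR_ge0// T2.
rewrite big_split/= -!mulr_sumr.
have hiB : \sum_(i < n) (lam i `^ (p - q) * \sum_x hi i x `^ q) <=
    r1 / (r1 - 1) * gam `^ (q - p) * \sum_x f x `^ p.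
  under eq_bigr do rewrite mulr_sumr.
  rewrite exchange_big mulr_sumr/=; apply: ler_sum => x _.
  rewrite (eq_bigr (fun i : 'I_n => if gam * lam i < f x then
     f x `^ q * lam i `^ (p - q) else 0)) => [|i _]; last first.
    by rewrite /hi; case: ifP => _; [exact: mulrC|rewrite powR0 ?mulr0// gt_eqF].
  rewrite -big_mkcond -mulr_sumr/=.
  have [fx0|fx0] := eqVneq (f x) 0;
    first by rewrite fx0 powR0 ?gt_eqF// mul0r !mulr_ge0 ?invr_ge0 ?powR_ge0
      ?subr_ge0 ?(ltW r11)// ltW.
  have fxgt : 0 < f x by rewrite lt_def fx0 f0.
  have ig0 : 0 <= gam^-1 by rewrite invr_ge0 ltW.
  pose Y := (f x / gam) `^ (p - q).
  apply: (@le_trans _ _ (f x `^ q * (r1 / (r1 - 1) * Y))).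
    rewrite ler_wpM2l ?powR_ge0//.
    have := geometric_sum_le_up n r11 (powR_ge0 eta (p - q))
      (powR_ge0 (f x / gam) (p - q)).
    apply: le_trans; rewrite big_mkcond [leRHS]big_mkcond; apply: ler_sum => i _.
    rewrite -lamX; case: ifP => h; last by case: ifP => // _; exact: powR_ge0.
    rewrite ifT// powR_le ?subr_ge0 ?(ltW (lam0 i)) ?(ltW qp)//.
    by rewrite ler_pdivlMr// mulrC ltW.
  rewrite /Y powRM ?(ltW fxgt)// -[q - p]opprB powRN.
  rewrite (powRV _ (ltW gam0)).
  rewrite [leLHS](_ : _ =
    r1 / (r1 - 1) * (gam `^ (p - q))^-1 * (f x `^ q * f x `^ (p - q)));
      last by ring.
  by rewrite -powRD ?fx0 ?implybT// subrKC.
have loB : \sum_(i < n) (lam i `^ (p - 2) * \sum_x lo i x ^+ 2) <=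
    (1 - r2)^-1 * gam `^ (2 - p) * \sum_x f x `^ p.
  under eq_bigr do rewrite mulr_sumr.
  rewrite exchange_big mulr_sumr/=; apply: ler_sum => x _.
  have [fx0|fx0] := eqVneq (f x) 0.
    rewrite big1 => [|i _]; last by rewrite /lo fx0 if_same expr0n mulr0.
    by rewrite !mulr_ge0 ?invr_ge0 ?powR_ge0// subr_ge0 ltW//; case/andP: r21.
  have fxgt : 0 < f x by rewrite lt_def fx0 f0.
  have ig0 : 0 <= gam^-1 by rewrite invr_ge0 ltW.
  rewrite (eq_bigr (fun i : 'I_n => if f x <= gam * lam i then
     f x ^+ 2 * lam i `^ (p - 2) else 0)) => [|i _]; last first.
    by rewrite /lo leNgt; case: ifP => _ /=; [rewrite expr0n mulr0|exact: mulrC].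
  rewrite -big_mkcond -mulr_sumr/=.
  pose Y := (f x / gam) `^ (p - 2).
  apply: (@le_trans _ _ (f x ^+ 2 * (Y / (1 - r2)))).
    rewrite ler_wpM2l ?sqr_ge0//.
    have := geometric_sum_le_down n r21 (powR_ge0 eta (p - 2))
      (powR_ge0 (f x / gam) (p - 2)).
    apply: le_trans; rewrite big_mkcond [leRHS]big_mkcond; apply: ler_sum => i _.
    rewrite -lamX; case: ifP => h; last by case: ifP => // _; exact: powR_ge0.
    rewrite ifT// -opprB !powRN lef_pV2 ?posrE ?powR_gt0 ?divr_gt0//.
    rewrite powR_le ?subr_ge0 ?(ltW p2) ?divr_ge0 ?(ltW gam0)//.
    by rewrite ler_pdivrMr// mulrC.
  rewrite /Y powRM ?(ltW fxgt)// -[2 - p]opprB powRN.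
  rewrite (powRV _ (ltW gam0)).
  rewrite [leLHS](_ : _ =
    (1 - r2)^-1 * (gam `^ (p - 2))^-1 * (f x ^+ 2 * f x `^ (p - 2))); last by ring.
  by rewrite -powR_mulrn// -powRD ?fx0 ?implybT// subrKC.
set F := \sum_x f x `^ p in hiB loB *.
have F0 : 0 <= F by apply: sumr_ge0 => x _; exact: powR_ge0.
have C1 : 0 <= 2 `^ (p - q) * 4 `^ q * B by rewrite !mulr_ge0 ?powR_ge0.
have C2 : 0 <= 16 * e by rewrite mulr_ge0.
apply: (le_trans (lerD (ler_wpM2l C1 hiB) (ler_wpM2l C2 loB))).
set g1 := gam `^ _; set g2 := gam `^ _.
rewrite [leLHS](_ : _ = (K1 * (B * g1) + K2 * (e * g2)) * F);
  last by rewrite /K1 /K2; ring.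
apply: ler_wpM2r => //.
have := mulr_ge0 (ltW K20) (mulr_ge0 B0 (powR_ge0 gam (q - p))).
have := mulr_ge0 (ltW K10) (mulr_ge0 e0 (powR_ge0 gam (2 - p))).
rewrite -/g1 -/g2; lra.
Qed.

End Interpolation.

(** * Symbols of one-dimensional averages *)
Section SquaredModulus.
Variable R : realType.
Implicit Types z u v : R[i].

(** The square of the modulus, as an element of R, so that the arithmetic of
    ordered fields applies. *)
Definition sqmod z : R := complex.Re z ^+ 2 + complex.Im z ^+ 2.

Lemma sqmod_ge0 z : 0 <= sqmod z.
Proof. by rewrite addr_ge0 ?sqr_ge0. Qed.

Lemma sqmodM u v : sqmod (u * v) = sqmod u * sqmod v.
Proof. case: u v => [a b] [c d]; rewrite /sqmod /=; ring. Qed.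

Lemma sqmod1 : sqmod 1 = 1.
Proof. by rewrite /sqmod/= expr0n/= expr1n addr0. Qed.

Lemma sqmod_real (r : R) : sqmod (r%:C)%C = r ^+ 2.
Proof. by rewrite /sqmod/= expr0n/= addr0. Qed.

Lemma sqmodX z n : sqmod (z ^+ n) = sqmod z ^+ n.
Proof. by elim: n => [|n IH]; rewrite ?expr0 ?sqmod1// !exprS sqmodM IH. Qed.

Lemma sqmodB u v : sqmod (u - v) = sqmod (v - u).
Proof. case: u v => [a b] [c d]; rewrite /sqmod /=; ring. Qed.

Lemma sqmodD_le u v : sqmod (u + v) <= 2 * (sqmod u + sqmod v).
Proof.
case: u v => [a b] [c d]; rewrite /sqmod /=.
have := sqr_ge0 (a - c); have := sqr_ge0 (b - d); nra.
Qed.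

Lemma sqmodE z : ((sqmod z)%:C = z * z^*)%C.
Proof. by case: z => [a b]; rewrite /sqmod/=; apply/eqP; rewrite eq_complex/=;
  apply/andP; split; apply/eqP; ring. Qed.

Lemma Re_sum (I : Type) (r : seq I) (F : I -> R[i]) :
  complex.Re (\sum_(i <- r) F i) = \sum_(i <- r) complex.Re (F i).
Proof.
elim: r => [|i r IH]; first by rewrite !big_nil.
rewrite !big_cons -IH.
by case: (F i) => a b; case: (\sum_(j <- r) F j) => c d.
Qed.

Lemma Im_sum (I : Type) (r : seq I) (F : I -> R[i]) :
  complex.Im (\sum_(i <- r) F i) = \sum_(i <- r) complex.Im (F i).
Proof.
elim: r => [|i r IH]; first by rewrite !big_nil.
rewrite !big_cons -IH.
by case: (F i) => a b; case: (\sum_(j <- r) F j) => c d.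
Qed.

Lemma sum_sqr_diff n (x : nat -> R) :
  \sum_(j < n) \sum_(k < n) (x j - x k) ^+ 2 =
  2 * (n%:R * (\sum_(j < n) x j ^+ 2) - (\sum_(j < n) x j) ^+ 2).
Proof.
rewrite (eq_bigr (fun j : 'I_n => x j ^+ 2 * n%:R +
  (\sum_(k < n) x k ^+ 2 - 2 * (\sum_(k < n) x k) * x j))) => [|j _]; last first.
  rewrite (eq_bigr (fun k : 'I_n =>
    x j ^+ 2 + (x k ^+ 2 - 2 * x j * x k))) => [|k _]; last ring.
  rewrite big_split/= sumrB sumr_const card_ord -mulr_sumr -mulr_natr; ring.
rewrite big_split/= sumrB sumr_const card_ord -mulr_suml -mulr_sumr -mulr_natr;
  ring.
Qed.

Lemma sum_sqmod_diff n (u : nat -> R[i]) : (forall j, sqmod (u j) = 1) ->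
  \sum_(j < n) \sum_(k < n) sqmod (u j - u k) =
  2 * (n%:R ^+ 2 - sqmod (\sum_(j < n) u j)).
Proof.
move=> u1; rewrite /sqmod Re_sum Im_sum.
rewrite (eq_bigr (fun j : 'I_n =>
  \sum_(k < n) (complex.Re (u j) - complex.Re (u k)) ^+ 2 +
   \sum_(k < n) (complex.Im (u j) - complex.Im (u k)) ^+ 2)) => [|j _]; last first.
  rewrite -big_split/=; apply: eq_bigr => k _.
  by case: (u j) (u k) => [a b] [c d].
rewrite big_split/= (sum_sqr_diff _ (fun j => complex.Re (u j))).
rewrite (sum_sqr_diff _ (fun j => complex.Im (u j))).
have e : n%:R = \sum_(j < n) complex.Re (u j) ^+ 2 + \sum_(j < n) complex.Im (u
  j) ^+ 2.
  rewrite -big_split/= (eq_bigr (fun=> 1)) => [|j _]; last exact: u1.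
  by rewrite sumr_const card_ord.
rewrite [n%:R ^+ 2](_ : _ = n%:R * n%:R)// [X in _ = 2 * (_ * X - _)]e; ring.
Qed.

Lemma sum_const2 n (x : R) : \sum_(j < n) \sum_(k < n) x = n%:R ^+ 2 * x.
Proof. by rewrite !sumr_const !card_ord -mulrnA mulnn -natrX mulr_natl. Qed.

Lemma sum_shift_le (F : nat -> R) s h n : (forall j, 0 <= F j) ->
  (s + h <= n)%N -> \sum_(i < h) F (s + i)%N <= \sum_(j < n) F j.
Proof.
move=> F0 sn; rewrite -(big_mkord xpredT F) (@big_cat_nat _ _ _ s)//=; last first.
  by rewrite (leq_trans _ sn)// leq_addr.
rewrite (@big_cat_nat _ _ _ (s + h) s n)//= ?leq_addr//.
have -> : \sum_(s <= j < s + h) F j = \sum_(i < h) F (s + i)%N.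
  rewrite -[X in \sum_(X <= _ < _) _]add0n big_addn addKn big_mkord.
  by apply: eq_bigr => i _; rewrite addnC.
by rewrite addrCA lerDl addr_ge0// big_nat sumr_ge0.
Qed.

End SquaredModulus.

Section FejerSymbol.
Variable R : realType.
Implicit Types z : R[i].

(** The symbol of the triangle function obtained by convolving the uniform
    measure on n consecutive integers with its reflection. *)
Definition fejer (n : nat) z : R := sqmod (\sum_(k < n) z ^+ k) / n%:R ^+ 2.

Lemma fejer_ge0 n z : 0 <= fejer n z.
Proof. by rewrite divr_ge0 ?sqmod_ge0 ?sqr_ge0. Qed.

Section UnitCircle.
Variable z : R[i].
Hypothesis z1 : sqmod z = 1.

Let zX k : sqmod (z ^+ k) = 1. Proof. by rewrite sqmodX z1 expr1n. Qed.

(** Expanding the squares, the gap 1 - F is the mean of the squared distances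
    between the points z ^ j. *)
Lemma fejer_gap n : (0 < n)%N -> (1 - fejer n z) * (2 * n%:R ^+ 2) =
  \sum_(j < n) \sum_(k < n) sqmod (z ^+ j - z ^+ k).
Proof.
move=> n0; rewrite (sum_sqmod_diff _ zX) /fejer; field.
by rewrite pnatr_eq0 -lt0n.
Qed.

Lemma fejer_le1 n : (0 < n)%N -> fejer n z <= 1.
Proof.
move=> n0; have : 0 <= (1 - fejer n z) * (2 * n%:R ^+ 2).
  rewrite fejer_gap//; apply: sumr_ge0 => j _; apply: sumr_ge0 => k _.
  exact: sqmod_ge0.
by rewrite pmulr_lge0 ?subr_ge0// mulr_gt0// exprn_gt0// ltr0n.
Qed.

Lemma sqmod_geometric_le n : sqmod (\sum_(k < n) z ^+ k) <= n%:R ^+ 2.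
Proof.
case: n => [|n]; first by rewrite big_ord0 expr0n/= /sqmod/= expr0n addr0.
have := @fejer_le1 n.+1 isT; rewrite /fejer ler_pdivrMr ?mul1r//.
Qed.

Lemma sqmod_sub1X n :
  sqmod (1 - z ^+ n) = sqmod (1 - z) * sqmod (\sum_(k < n) z ^+ k).
Proof. by rewrite sqmodB [sqmod (1 - z)]sqmodB -sqmodM subrX1. Qed.

Lemma sqmod_sub1X_le n : sqmod (1 - z ^+ n) <= n%:R ^+ 2 * sqmod (1 - z).
Proof.
by rewrite sqmod_sub1X mulrC ler_wpM2r ?sqmod_ge0// sqmod_geometric_le.
Qed.

(** Each of the two legs of the chord from z ^ j to z ^ (j + n) through
    z ^ (h + i) joins, up to a rotation, two of the n points. *)
Lemma fejer_gap_ge n : (1 < n)%N -> sqmod (1 - z ^+ n) <= 72 * (1 - fejer n z).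
Proof.
move=> n1; have n0 : (0 < n)%N by exact: ltnW.
pose h := n./2.
have hn : (h + h <= n)%N by rewrite addnn -[leqRHS]odd_double_half leq_addl.
have nh : (n <= 3 * h)%N.
  rewrite /h; move: n1; rewrite -{1 2}(odd_double_half n) -mul2n.
  by case: (odd n) => /=; case: n./2 => [|m]//=; lia.
pose S := \sum_(j < n) \sum_(k < n) sqmod (z ^+ j - z ^+ k).
have S1 : \sum_(j < h) \sum_(i < h) sqmod (z ^+ j - z ^+ (h + i)) <= S.
  apply: le_trans (@sum_shift_le R (fun j =>
    \sum_(k < n) sqmod (z ^+ j - z ^+ k)) 0 h n _ _).
  - apply: ler_sum => j _; rewrite add0n.
    apply: (@sum_shift_le R (fun k => sqmod (z ^+ j - z ^+ k))) => // k.
    exact: sqmod_ge0.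
  - by move=> j; apply: sumr_ge0 => k _; exact: sqmod_ge0.
  - by rewrite add0n (leq_trans _ hn)// leq_addr.
have S2 : \sum_(j < h) \sum_(i < h) sqmod (z ^+ (n - h + j) - z ^+ i) <= S.
  apply: le_trans (@sum_shift_le R (fun j =>
    \sum_(k < n) sqmod (z ^+ j - z ^+ k)) (n - h) h n _ _).
  - apply: ler_sum => j _.
    apply: (@sum_shift_le R (fun k => sqmod (z ^+ (n - h + j) - z ^+ k)) 0) => [k|].
      exact: sqmod_ge0.
    by rewrite add0n (leq_trans _ hn)// leq_addr.
  - by move=> j; apply: sumr_ge0 => k _; exact: sqmod_ge0.
  - by rewrite subnK// (leq_trans _ hn)// leq_addr.
have S12 : h%:R ^+ 2 * sqmod (1 - z ^+ n) <= 2 * (S + S).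
  apply: le_trans (_ : 2 * (\sum_(j < h) \sum_(i < h) sqmod (z ^+ j - z ^+ (h +
    i)) +
     \sum_(j < h) \sum_(i < h) sqmod (z ^+ (n - h + j) - z ^+ i)) <= _); last first.
    by rewrite ler_wpM2l// lerD.
  rewrite -big_split/= mulr_sumr.
  rewrite [leLHS](_ : _ = \sum_(j < h) \sum_(i < h) sqmod (1 - z ^+ n)).
    apply: ler_sum => j _; rewrite -big_split/= mulr_sumr; apply: ler_sum => i _.
    rewrite -[leLHS]mul1r -[X in X * _ <= _](zX j) -sqmodM mulrBr mulr1.
    rewrite (_ : z ^+ j - z ^+ j * z ^+ n = (z ^+ j - z ^+ (h + i)) +
      z ^+ h * (z ^+ i - z ^+ (n - h + j))); last first.
      rewrite mulrBr -!exprD addrA subrK; congr (_ - z ^+ _).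
      lia.
    apply: (le_trans (sqmodD_le _ _)).
    by rewrite sqmodM zX mul1r [sqmod (z ^+ i - _)]sqmodB.
  by rewrite sum_const2.
have := fejer_gap n0; rewrite -/S => gap.
have hR : n%:R <= 3 * h%:R :> R by rewrite -natrM ler_nat.
have nR : 0 < n%:R :> R by rewrite ltr0n.
have h2 : n%:R ^+ 2 <= 9 * h%:R ^+ 2 :> R by nra.
have : n%:R ^+ 2 * sqmod (1 - z ^+ n) <= n%:R ^+ 2 * (72 * (1 - fejer n z)).
  apply: le_trans (ler_wpM2r (sqmod_ge0 _) h2) _; lra.
by rewrite ler_pM2l// exprn_gt0.
Qed.

(** Decay at large frequencies and strict contraction at small ones in a single
    inequality, of a form that is stable under products over the coordinates,
    see [prod_decay]. It rests on F n^2 |1 - z|^2 = |1 - z ^ n|^2. *)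
Lemma fejer_decay n : (1 < n)%N ->
  fejer n z * (1 + n%:R ^+ 2 * sqmod (1 - z) / 72) <= 1.
Proof.
move=> n1; have := fejer_gap_ge n1; rewrite sqmod_sub1X.
have -> : sqmod (\sum_(k < n) z ^+ k) = fejer n z * n%:R ^+ 2.
  by rewrite /fejer divfK// expf_neq0// pnatr_eq0 -lt0n ltnW.
lra.
Qed.

Lemma fejer_small n : (0 < n)%N ->
  1 - fejer n z <= n%:R ^+ 2 * sqmod (1 - z) / 2.
Proof.
move=> n0; have nR : 0 < 2 * n%:R ^+ 2 :> R by rewrite mulr_gt0// exprn_gt0// ltr0n.
rewrite -(ler_pM2r nR) fejer_gap//.
apply: (@le_trans _ _ (\sum_(j < n) \sum_(k < n) n%:R ^+ 2 * sqmod (1 - z))).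
  apply: ler_sum => j _; apply: ler_sum => k _.
  have mono m : (m < n)%N -> sqmod (1 - z ^+ m) <= n%:R ^+ 2 * sqmod (1 - z).
    move=> mn; apply: (le_trans (sqmod_sub1X_le m)).
    by rewrite ler_wpM2r ?sqmod_ge0// ler_pXn2r ?nnegrE// ler_nat ltnW.
  wlog jk : j k / (j <= k)%N => [hw|].
    have [/hw//|/ltnW/hw] := leqP j k.
    by rewrite sqmodB.
  rewrite -(subnKC jk) exprD -[X in X - _]mulr1 -mulrBr sqmodM zX mul1r.
  by apply: mono; rewrite (leq_ltn_trans (leq_subr _ _)).
by rewrite sum_const2 le_eqVlt; apply/orP; left; apply/eqP; field.
Qed.

(** Two adjacent intervals of length n make one of length 2n, whose symbol
    has the extra factor |1 + z ^ n|^2 / 4. *)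
Lemma fejer_double n : fejer (n + n) z <= fejer n z.
Proof.
case: n => [|n]; first exact: lexx.
rewrite /fejer.
have -> : \sum_(k < n.+1 + n.+1) z ^+ k = (1 + z ^+ n.+1) * \sum_(k < n.+1) z ^+ k.
  rewrite big_split_ord/= mulrDl mul1r mulr_sumr; congr (_ + _).
  by apply: eq_bigr => k _; rewrite exprD.
have n0 : 0 < n.+1%:R ^+ 2 :> R by rewrite exprn_gt0// ltr0n.
rewrite addnn -mul2n natrM exprMn invfM mulrA ler_pM2r ?invr_gt0//.
rewrite ler_pdivrMr ?exprn_gt0// sqmodM [leRHS]mulrC.
rewrite ler_wpM2r ?sqmod_ge0// (le_trans (sqmodD_le _ _))//.
by rewrite sqmod1 zX; lra.
Qed.

End UnitCircle.

End FejerSymbol.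

(** * Symbols of averages over cubes *)
Lemma sum_dist_eq_le (R : realType) J (j : 'I_J) k (t : R) : 0 <= t ->
  \sum_(n < J | ((n - j) + (j - n) == k)%N) t <= 2 * t.
Proof.
move=> t0.
apply: (@le_trans _ _ (\sum_(n < J) ((if (n == j + k :> nat)%N then t else 0) +
     (if (n == j - k :> nat)%N then t else 0)))).
  rewrite big_mkcond; apply: ler_sum => n _; case: ifP => h.
    case: eqP => e1; first by case: eqP => _; rewrite ?addr0// lerDl.
    case: eqP => e2; first by rewrite add0r.
    lia.
  by rewrite addr_ge0//; case: ifP.
have one m : \sum_(n < J) (if n == m :> nat then t else 0) <= t.
  by rewrite -big_mkcond (big_ord1_eq _ (fun=> t)); case: ifP.
by rewrite big_split/= mulrDl !mul1r; exact: lerD (one _) (one _).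
Qed.

Section CubeSymbols.
Variable R : realType.
Implicit Types z : R[i].

(** The symbol of the uniform measure on [-N, N]; only its real part is kept,
    see [cube_symbol1E]. *)
Definition cube_symbol1 (N : nat) z : R :=
  complex.Re (\sum_(k < N.*2.+1) z ^+ k * (z^*)%C ^+ N) / N.*2.+1%:R.

Section UnitCircle.
Variable z : R[i].
Hypothesis z1 : sqmod z = 1.

Let zX k : sqmod (z ^+ k) = 1. Proof. by rewrite sqmodX z1 expr1n. Qed.
Let zJ : z * (z^*)%C = 1. Proof. by rewrite -sqmodE z1. Qed.
Let zJX k : z ^+ k * (z^*)%C ^+ k = 1. Proof. by rewrite -exprMn zJ expr1n. Qed.
Let sqmodJ : sqmod (z^*)%C = 1.
Proof. by move: z1; case: (z) => a b; rewrite /sqmod/= sqrrN. Qed.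

(** The interval [-N, N] is symmetric, so that its symbol is real: reversing the
    order of summation conjugates each term. *)
Lemma cube_symbol1E N :
  \sum_(k < N.*2.+1) z ^+ k * (z^*)%C ^+ N =
    ((cube_symbol1 N z * N.*2.+1%:R)%:C)%C.
Proof.
rewrite /cube_symbol1 divfK ?pnatr_eq0//.
set S := \sum_(k < _) _.
suff SJ : (S^*)%C = S.
  by move: SJ; case: (S) => a b [] /= e; congr (_ +i* _)%C; lra.
rewrite /S raddf_sum/= (reindex_inj rev_ord_inj)/=; apply: eq_bigr => k _.
rewrite rmorphM !rmorphXn/= conjcK subSS.
have kN : (k <= N.*2)%N by rewrite -ltnS.
rewrite -[LHS]mulr1 -(zJX k) -[RHS]mulr1 -(zJX N).
rewrite (_ : (z^*)%C ^+ (N.*2 - k) * z ^+ N * (z ^+ k * (z^*)%C ^+ k) =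
   (z^*)%C ^+ (N.*2 - k + k) * z ^+ N * z ^+ k); last by rewrite exprD; ring.
by rewrite subnK// -[X in _ ^+ X * _ * _]addnn exprD; ring.
Qed.

Lemma cube_symbol1_sqr N : cube_symbol1 N z ^+ 2 = fejer N.*2.+1 z.
Proof.
rewrite /fejer; have := congr1 (@sqmod R) (cube_symbol1E N).
rewrite -mulr_suml sqmodM sqmod_real sqmodX sqmodJ expr1n mulr1 => ->.
by rewrite [in RHS]exprMn mulfK// sqrf_eq0 pnatr_eq0.
Qed.

Lemma cube_symbol1_norm_le1 N : `|cube_symbol1 N z| <= 1.
Proof.
by rewrite -(@expr_le1 _ 2)// real_normK ?num_real// cube_symbol1_sqr fejer_le1.
Qed.

(** For u of modulus 1, 1 - Re u = |1 - u|^2 / 2, and each z ^ k with |k| <= N is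
    within N |1 - z| of 1. *)
Lemma cube_symbol1_small N :
  1 - cube_symbol1 N z <= N%:R ^+ 2 * sqmod (1 - z) / 2.
Proof.
have L0 : 0 < N.*2.+1%:R :> R by rewrite ltr0n.
rewrite -(ler_pM2r L0) mulrBl mul1r {1}/cube_symbol1 divfK ?gt_eqF// Re_sum.
rewrite -{1}(card_ord N.*2.+1) -sumr_const -sumrB.
rewrite mulr_natr -[X in _ *+ X](card_ord N.*2.+1) -sumr_const.
apply: ler_sum => k _; set u := z ^+ k * _.
have u1 : sqmod u = 1 by rewrite sqmodM sqmodX z1 sqmodX sqmodJ !expr1n mulr1.
have -> : 1 - complex.Re u = sqmod (1 - u) / 2.
  by move: u1; case: (u) => a b; rewrite /sqmod/=; nra.
rewrite ler_pM2r ?invr_gt0// -[leLHS]mul1r -[X in X * _ <= _](zX N) -sqmodM.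
rewrite mulrBr mulr1 /u mulrCA zJX mulr1.
have mono m : (m <= N)%N -> sqmod (1 - z ^+ m) <= N%:R ^+ 2 * sqmod (1 - z).
  move=> mn; apply: (le_trans (sqmod_sub1X_le z1 m)).
  by rewrite ler_wpM2r ?sqmod_ge0// ler_pXn2r ?nnegrE// ler_nat.
have [Nk|/ltnW kN] := leqP N k.
  rewrite -(subnKC Nk) exprD -[X in X - _]mulr1 -mulrBr sqmodM zX mul1r mono//.
  by have := ltn_ord k; lia.
rewrite sqmodB (_ : z ^+ N = z ^+ k * z ^+ (N - k)); last first.
  by rewrite -exprD subnKC.
rewrite -[X in X - _]mulr1 -mulrBr sqmodM zX mul1r.
by rewrite mono// leq_subr.
Qed.

End UnitCircle.

Section Products.
Variable I : Type.
Implicit Types (r : seq I) (f t : I -> R).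

(** The bound survives the product without any loss, because
    1 + t + s <= (1 + t)(1 + s): this is what makes the estimates independent
    of the dimension. *)
Lemma prod_decay r f t : (forall i, 0 <= f i) -> (forall i, 0 <= t i) ->
  (forall i, f i * (1 + t i) <= 1) ->
  (\prod_(i <- r) f i) * (1 + \sum_(i <- r) t i) <= 1.
Proof.
move=> f0 t0 ft; elim: r => [|i r IH]; first by rewrite !big_nil addr0 mulr1.
rewrite !big_cons; set p := \prod_(j <- r) _ in IH *.
set s := \sum_(j <- r) _ in IH *.
have p0 : 0 <= p by exact: prodr_ge0.
have s0 : 0 <= s by exact: sumr_ge0.
apply: (@le_trans _ _ ((f i * (1 + t i)) * (p * (1 + s)))).
  have := mulr_ge0 (mulr_ge0 (f0 i) p0) (mulr_ge0 (t0 i) s0); lra.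
by rewrite mulr_ile1 ?ft// !mulr_ge0 ?addr_ge0.
Qed.

Lemma prod_norm_le1 r f : (forall i, `|f i| <= 1) -> `|\prod_(i <- r) f i| <= 1.
Proof.
move=> f1; elim/big_ind: _ => // [|x y x1 y1]; first by rewrite normr1.
by rewrite normrM mulr_ile1.
Qed.

Lemma one_sub_prod_le r f : (forall i, `|f i| <= 1) ->
  1 - \prod_(i <- r) f i <= \sum_(i <- r) (1 - f i).
Proof.
move=> f1; elim: r => [|i r IH]; first by rewrite !big_nil subrr.
rewrite !big_cons; have := prod_norm_le1 r f1; have := f1 i.
rewrite !ler_norml => /andP[a1 a2] /andP[b1 b2]; nra.
Qed.

End Products.

Section Multidimensional.
Variables (I : finType) (z : I -> R[i]).
Hypothesis z1 : forall i, sqmod (z i) = 1.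

Definition cube_symbol N : R := \prod_i cube_symbol1 N (z i).

(** The symbol of the dyadic averages of side 2 ^ n, averaged over all
    translates of the dyadic grid. *)
Definition dyadic_symbol n : R := \prod_i fejer (2 ^ n) (z i).

Let s : R := \sum_i sqmod (1 - z i).

Let s0 : 0 <= s. Proof. by apply: sumr_ge0 => i _; exact: sqmod_ge0. Qed.

Let pow2_gt0 n : (0 < 2 ^ n)%N. Proof. by rewrite expn_gt0. Qed.

Let pow2_sqr n : (2 ^ n)%N%:R ^+ 2 = 4 ^+ n :> R.
Proof. by rewrite -!natrX -expnM mulnC expnM. Qed.

Lemma dyadic_symbol_ge0 n : 0 <= dyadic_symbol n.
Proof. by apply: prodr_ge0 => i _; exact: fejer_ge0. Qed.

Lemma dyadic_symbol_le1 n : dyadic_symbol n <= 1.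
Proof.
rewrite -(ger0_norm (dyadic_symbol_ge0 n)); apply: prod_norm_le1 => i.
by rewrite ger0_norm ?fejer_ge0// fejer_le1.
Qed.

Lemma dyadic_symbolS n : dyadic_symbol n.+1 <= dyadic_symbol n.
Proof.
apply: ler_prod => i _; rewrite fejer_ge0/= expnS mul2n -addnn.
exact: fejer_double.
Qed.

Let dyadic_decay n : (0 < n)%N -> dyadic_symbol n * (4 ^+ n * s) <= 72.
Proof.
move=> n0; have n2 : (1 < 2 ^ n)%N by rewrite -{1}(expn0 2) ltn_exp2l.
have h := @prod_decay _ (index_enum I) (fun i => fejer (2 ^ n) (z i))
  (fun i => 4 ^+ n * sqmod (1 - z i) / 72).
rewrite -mulr_suml -mulr_sumr -/s -/(dyadic_symbol n) in h.
have dec i : fejer (2 ^ n) (z i) * (1 + 4 ^+ n * sqmod (1 - z i) / 72) <= 1.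
  by have := fejer_decay (z1 i) n2; rewrite pow2_sqr.
have {h} := h _ _ dec.
have := dyadic_symbol_ge0 n; set p := dyadic_symbol n => p0 h.
have {h} : p * (1 + 4 ^+ n * s / 72) <= 1.
  apply: h => i; first exact: fejer_ge0.
  by rewrite !mulr_ge0 ?sqmod_ge0 ?exprn_ge0.
lra.
Qed.

Let dyadic_small n : 1 - dyadic_symbol n <= 4 ^+ n * s / 2.
Proof.
apply: le_trans (one_sub_prod_le _ _) _ => [i|].
  by rewrite ger0_norm ?fejer_ge0// fejer_le1.
rewrite [leRHS]mulrAC mulr_sumr; apply: ler_sum => i _.
apply: (le_trans (fejer_small (z1 i) (pow2_gt0 n))).
by rewrite pow2_sqr mulrAC.
Qed.

Let cube_decay n N : (2 ^ n <= N)%N -> cube_symbol N ^+ 2 * (4 ^+ n * s) <= 72.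
Proof.
move=> nN; have N0 : (0 < N)%N := leq_trans (pow2_gt0 n) nN.
have := @prod_decay _ (index_enum I) (fun i => fejer N.*2.+1 (z i))
  (fun i => N.*2.+1%:R ^+ 2 * sqmod (1 - z i) / 72).
rewrite -mulr_suml -mulr_sumr -/s.
rewrite (_ : \prod_i _ = cube_symbol N ^+ 2); last first.
  by rewrite -prodrXl; apply: eq_bigr => i _; rewrite cube_symbol1_sqr.
have N2 : (1 < N.*2.+1)%N by rewrite ltnS double_gt0.
move=> h; have {h} := h _ _ (fun i => fejer_decay (z1 i) N2).
set p := cube_symbol N ^+ 2 => h.
have {h} : p * (1 + N.*2.+1%:R ^+ 2 * s / 72) <= 1.
  apply: h => i; first exact: fejer_ge0.
  by rewrite !mulr_ge0 ?sqmod_ge0 ?exprn_ge0.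
have p0 : 0 <= p by exact: sqr_ge0.
have : (4 ^+ n : R) <= N.*2.+1%:R ^+ 2.
  rewrite -!natrX ler_nat (_ : 4 = 2 ^ 2)%N// -expnM mulnC expnM leq_exp2r//.
  by rewrite (leq_trans nN)// -addnn -addnS leq_addr.
move=> h1 h2.
have := ler_wpM2l p0 (ler_wpM2r s0 h1); lra.
Qed.

Let cube_small n N : (N < 2 ^ n.+1)%N -> 1 - cube_symbol N <= 2 * (4 ^+ n * s).
Proof.
move=> nN.
apply: le_trans (one_sub_prod_le _ _) _ => [i|]; first exact: cube_symbol1_norm_le1.
rewrite mulrA mulr_sumr; apply: ler_sum => i _.
apply: (le_trans (cube_symbol1_small (z1 i) N)).
rewrite mulrAC ler_wpM2r ?sqmod_ge0// ler_pdivrMr//.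
rewrite (_ : 2 * 4 ^+ n * 2 = (4 ^ n.+1)%N%:R); last first.
  by rewrite natrX exprS; ring.
rewrite -natrX ler_nat (_ : 4 = 2 ^ 2)%N// -expnM mulnC expnM leq_exp2r//.
exact: ltnW.
Qed.

(** Both symbols are within 4 ^ n s of 1 and are O(1 / (4 ^ n s)), where s is the
    sum of the |1 - z_i|^2 (the square of the cube symbol, rather than the
    symbol itself, in the second bound). If n < j, the smallness of the
    difference at scale n meets the decay of the dyadic symbol at scale j; if
    j < n, the decay of the difference at scale n meets the smallness of
    1 - dyadic symbol at scale j + 1. *)
Lemma cube_dyadic_symbol_decay n N j : (2 ^ n <= N < 2 ^ n.+1)%N ->
  (cube_symbol N - dyadic_symbol n) ^+ 2 *
    (dyadic_symbol j - dyadic_symbol j.+1) * 4 ^+ ((n - j) + (j - n)) <= 576.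
Proof.
move=> /andP[nN Nn].
have p0 := dyadic_symbol_ge0 n; have p1 := dyadic_symbol_le1 n.
have q0 := dyadic_symbol_ge0 j; have q1 := dyadic_symbol_le1 j.
have r0 := dyadic_symbol_ge0 j.+1; have r1 := dyadic_symbol_le1 j.+1.
have qr := dyadic_symbolS j.
have := prod_norm_le1 (index_enum I) (fun i => cube_symbol1_norm_le1 (z1 i) N).
rewrite -/(cube_symbol N) ler_norml => /andP[m0 m1].
have cs := cube_small Nn; have cd := cube_decay nN.
have ds := dyadic_small n.
move: p0 p1 m0 m1 cs cd ds; set m := cube_symbol N; set p := dyadic_symbol n.
set w := 4 ^+ n * s => p0 p1 m0 m1 cs cd ds.
have d4 : (m - p) ^+ 2 <= 4 by nra.
have w0 : 0 <= w by rewrite mulr_ge0 ?exprn_ge0.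
have [jn|nj|<-] := ltngtP j n.
- have dd := dyadic_decay (leq_ltn_trans (leq0n j) jn).
  have rs := dyadic_small j.+1.
  rewrite (_ : j - n = 0)%N ?addn0; last by apply/eqP; rewrite subn_eq0 ltnW.
  have e : (4 ^+ n : R) = 4 ^+ (n - j) * 4 ^+ j by rewrite -exprD subnK// ltnW.
  set v := (4 ^+ (n - j) : R) in e *; have v0 : 0 <= v by rewrite exprn_ge0.
  have rs' : dyadic_symbol j - dyadic_symbol j.+1 <= 2 * (4 ^+ j * s).
    by rewrite exprS in rs; lra.
  have dw : (m - p) ^+ 2 * w <= 288.
    rewrite -/p -/w in dd.
    apply: (@le_trans _ _ ((2 * m ^+ 2 + 2 * p ^+ 2) * w)).
      by rewrite ler_wpM2r//; have := sqr_ge0 (m + p); nra.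
    have : p ^+ 2 * w <= p * w by rewrite ler_wpM2r//; nra.
    lra.
  apply: (@le_trans _ _ ((m - p) ^+ 2 * (2 * (4 ^+ j * s)) * v)).
    by rewrite ler_wpM2r// ler_wpM2l ?sqr_ge0.
  rewrite (_ : _ * v = 2 * ((m - p) ^+ 2 * w)); last by rewrite /w e; ring.
  lra.
- have dd := dyadic_decay (leq_ltn_trans (leq0n n) nj).
  rewrite (_ : n - j = 0)%N ?add0n; last by apply/eqP; rewrite subn_eq0 ltnW.
  have e : (4 ^+ j : R) = 4 ^+ (j - n) * 4 ^+ n by rewrite -exprD subnK// ltnW.
  set v := (4 ^+ (j - n) : R) in e *; have v0 : 0 <= v by rewrite exprn_ge0.
  have dw : (m - p) ^+ 2 <= 4 * w.
    have : `|m - p| <= 2 * w by rewrite ler_norml; apply/andP; split; lra.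
    have : `|m - p| <= 2 by rewrite ler_norml; apply/andP; split; lra.
    have := normr_ge0 (m - p); rewrite -[_ ^+ 2](real_normK (num_real _)).
    set x := `|_|; nra.
  apply: (@le_trans _ _ (4 * w * dyadic_symbol j * v)).
    rewrite ler_wpM2r// ler_pM ?sqr_ge0//; lra.
  rewrite (_ : _ * v = 4 * (dyadic_symbol j * (4 ^+ j * s))); last first.
    by rewrite /w e; ring.
  lra.
- rewrite subnn addn0 expr0 mulr1; nra.
Qed.

(** The dyadic differences are nonnegative and telescope, so their sum is at most
    1, and one factor of the squared difference pays for the summation over j. *)
Lemma cube_dyadic_symbol_sum J (N : nat -> nat) k :
  (forall n, (2 ^ n <= N n < 2 ^ n.+1)%N) ->
  \sum_(n < J) \sum_(j < J | ((n - j) + (j - n) == k)%N)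
    (cube_symbol (N n) - dyadic_symbol n) ^+ 2 *
    (dyadic_symbol j - dyadic_symbol j.+1) ^+ 2 <= 1152 / 4 ^+ k.
Proof.
move=> NN; set q := fun j => dyadic_symbol j - dyadic_symbol j.+1.
have k4 : 0 < 4 ^+ k :> R by rewrite exprn_gt0.
have q0 j : 0 <= q j by rewrite subr_ge0 dyadic_symbolS.
have D0 : 0 <= 576 / 4 ^+ k :> R := divr_ge0 (ler0n R 576) (ltW k4).
rewrite (exchange_big_dep xpredT)//=.
apply: (@le_trans _ _ (\sum_(j < J) (576 / 4 ^+ k) * (2 * q j))).
  apply: ler_sum => j _;
    apply: le_trans (ler_wpM2l _ (@sum_dist_eq_le R J j k _ (q0 j))); last first.
    exact: D0.
  rewrite mulr_sumr; apply: ler_sum => n /eqP <-.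
  rewrite [X in _ * X]expr2 mulrA ler_wpM2r ?(q0 j)// ler_pdivlMr ?exprn_gt0//.
  exact: cube_dyadic_symbol_decay.
rewrite -!mulr_sumr (sum_diff _ dyadic_symbol).
rewrite [leRHS](_ : _ = 576 / 4 ^+ k * 2); last by rewrite mulrAC -natrM.
apply: (ler_wpM2l D0).
have := dyadic_symbol_ge0 J; have := dyadic_symbol_le1 0; lra.
Qed.

End Multidimensional.
End CubeSymbols.

(** * Fourier analysis on the torus *)
Section Plancherel.
Variables (R : realType) (G : finZmodType) (X : finType).
Variable chi : X -> G -> R[i].
Hypothesis chiD : forall k x y, chi k (x + y) = chi k x * chi k y.
Hypothesis chi1 : forall k x, sqmod (chi k x) = 1.
Hypothesis chi_orthogonal : forall x, x != 0 -> \sum_k chi k x = 0.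
Implicit Types (f w : G -> R).

Definition fourier f (k : X) : R[i] := \sum_x (f x)%:C%C * chi k x.

Let chi_mul_conj k x y : chi k x * ((chi k y)^*)%C = chi k (x - y).
Proof.
have e : chi k x = chi k (x - y) * chi k y by rewrite -chiD subrK.
by rewrite e -mulrA -sqmodE chi1 mulr1.
Qed.

Let chi0 k : chi k 0 = 1.
Proof. by rewrite -(subrr 0) -chi_mul_conj -sqmodE chi1. Qed.

Lemma plancherel f :
  \sum_k sqmod (fourier f k) = #|X|%:R * \sum_x f x ^+ 2.
Proof.
apply: (fmorph_inj (real_complex R)).
rewrite rmorph_sum /=.
rewrite (eq_bigr (fun k => \sum_x \sum_y
   (f x)%:C%C * (f y)%:C%C * chi k (x - y))) => [|k _]; last first.
  rewrite sqmodE /fourier raddf_sum mulr_suml; apply: eq_bigr => x _.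
  rewrite mulr_sumr; apply: eq_bigr => y _.
  rewrite [X in _ * X = _](_ : _ = ((f y)%:C * (chi k y)^*)%C); last first.
    by rewrite -[in RHS]conjc_real -rmorphM.
  by rewrite mulrACA chi_mul_conj.
rewrite exchange_big rmorphM rmorph_sum mulr_sumr/=; apply: eq_bigr => x _.
rewrite exchange_big/= (bigD1 x)//= [X in _ + X]big1 => [|y yx]; last first.
  by rewrite -mulr_sumr chi_orthogonal ?mulr0// subr_eq0 eq_sym.
rewrite -mulr_sumr subrr addr0 (eq_bigr (fun=> 1)) => [|k _]; last exact: chi0.
by rewrite sumr_const rmorph_nat -rmorphM mulrC -expr2.
Qed.

Lemma fourier_conv w f k : fourier (conv w f) k = fourier w k * fourier f k.
Proof.
rewrite /fourier /conv mulr_suml.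
under eq_bigr do rewrite raddf_sum mulr_suml/=.
rewrite exchange_big/=; apply: eq_bigr => y _.
rewrite mulr_sumr [RHS](reindex_inj (addIr (- y)))/=; apply: eq_bigr => x _.
by rewrite rmorphM/= mulrACA -chiD [y + _]addrC subrK.
Qed.

Lemma fourierB w1 w2 k :
  fourier (fun y => w1 y - w2 y) k = fourier w1 k - fourier w2 k.
Proof.
by rewrite -sumrB; apply: eq_bigr => x _; rewrite rmorphB mulrBl.
Qed.

Lemma conv_family_l2 (I : finType) (P : pred I) (v w : I -> G -> R) e f :
  (0 < #|X|)%N ->
  (forall k, \sum_(i | P i)
    sqmod (fourier (v i) k) * sqmod (fourier (w i) k) <= e) ->
  \sum_x \sum_(i | P i) conv (v i) (conv (w i) f) x ^+ 2 <=
    e * \sum_x f x ^+ 2.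
Proof.
move=> X0 he; have X0' : 0 < #|X|%:R :> R by rewrite ltr0n.
rewrite -(ler_pM2l X0') mulrCA -!plancherel exchange_big mulr_sumr/=.
under eq_bigr do rewrite -plancherel.
rewrite exchange_big mulr_sumr/=; apply: ler_sum => k _.
under eq_bigr do rewrite !fourier_conv !sqmodM mulrA.
by rewrite -mulr_suml ler_wpM2r ?sqmod_ge0.
Qed.

End Plancherel.

Section UniformWeight.
Variables (R : realType) (G : finZmodType) (I : finType) (s : I -> G).

Definition uniform_weight (y : G) : R :=
  #|[pred i | s i == y]|%:R / #|I|%:R.

Lemma sum_fibre (A : pzRingType) (h : G -> A) :
  \sum_y #|[pred i | s i == y]|%:R * h y = \sum_i h (s i).
Proof.
rewrite [RHS](partition_big s xpredT)//=; apply: eq_bigr => y _.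
rewrite (eq_bigr (fun=> h y)) => [|i /eqP ->//].
by rewrite sumr_const mulr_natl.
Qed.

Lemma conv_uniform (f : G -> R) x :
  conv uniform_weight f x = (\sum_i f (x - s i)) / #|I|%:R.
Proof.
rewrite -(sum_fibre (fun y => f (x - y))) mulr_suml; apply: eq_bigr => y _.
by rewrite mulrAC.
Qed.

Lemma prob_uniform_weight : (0 < #|I|)%N -> prob_weight uniform_weight.
Proof.
move=> I0; split=> [y|]; first by rewrite divr_ge0.
rewrite -mulr_suml; have := sum_fibre (fun=> 1 : R).
under eq_bigr do rewrite mulr1.
by move=> ->; rewrite sumr_const divff// pnatr_eq0 -lt0n.
Qed.

Lemma fourier_uniform (X : finType) (chi : X -> G -> R[i]) k :
  fourier chi uniform_weight k = (\sum_i chi k (s i)) / #|I|%:R.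
Proof.
rewrite -(sum_fibre (chi k)) mulr_suml; apply: eq_bigr => y _.
by rewrite rmorphM/= fmorphV !rmorph_nat mulrAC.
Qed.

End UniformWeight.

Arguments uniform_weight R {G I} s y.

Definition torus (d m : nat) := {ffun 'I_d -> 'Z_m}.
HB.instance Definition _ (d m : nat) := GRing.Zmodule.on (torus d m).
HB.instance Definition _ (d m : nat) := Finite.on (torus d m).

(** An iterated square root of -1. *)
Lemma primitive_root_pow2 (R : realType) n :
  exists w : R[i], (2 ^ n.+1).-primitive_root w.
Proof.
have [w wn] : exists w : R[i], w ^+ (2 ^ n) = -1.
  elim: n => [|n [w wn]]; first by exists (-1); rewrite expn0 expr1.
  by exists (sqrtC w); rewrite expnS exprM sqrtCK.
have w1 : w ^+ (2 ^ n.+1) = 1.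
  by rewrite expnS mulnC exprM wn sqrrN expr1n.
have [m mw] := prim_order_exists (expn_gt0 2 n.+1) w1.
move=> /(dvdn_pfactor _ _ (isT : prime 2))[k kn mE].
exists w; suff -> : (2 ^ n.+1)%N = m by [].
rewrite mE; congr (2 ^ _)%N; apply/eqP; rewrite eqn_leq kn andbT ltnNge.
apply/negP => kn'; have := prim_order_dvd mw (2 ^ n).
rewrite mE dvdn_exp2l// wn eq_sym => /esym/eqP/(congr1 (@complex.Re R))/=.
lra.
Qed.

Section TorusCharacters.
Variables (R : realType) (d m : nat).
Variable w : R[i].
Hypothesis w_prim : (Zp_trunc m).+2.-primitive_root w.

Let sqmod_w : sqmod w = 1.
Proof.
apply/eqP; rewrite -(@pexpr_eq1 _ _ (Zp_trunc m).+2) ?sqmod_ge0//.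
by rewrite -sqmodX (prim_expr_order w_prim) sqmod1.
Qed.

Definition char1 (k x : 'Z_m) : R[i] := w ^+ (k * x).

Definition torus_char (k x : torus d m) : R[i] := \prod_i char1 (k i) (x i).

Lemma sqmod_char1 k x : sqmod (char1 k x) = 1.
Proof. by rewrite sqmodX sqmod_w expr1n. Qed.

Lemma char1D k x y : char1 k (x + y) = char1 k x * char1 k y.
Proof.
rewrite /char1 -exprD -mulnDr -(prim_expr_mod w_prim) /=.
by rewrite modnMmr (prim_expr_mod w_prim).
Qed.

Lemma char1_0 k : char1 k 0 = 1.
Proof. by rewrite /char1 muln0. Qed.

Lemma char1_nat k n : char1 k n%:R = char1 k 1 ^+ n.
Proof.
elim: n => [|n IH]; first by rewrite char1_0.
by rewrite -natr1 char1D IH exprSr.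
Qed.

Lemma char1N k x : char1 k (- x) = (char1 k x)^*%C.
Proof.
have : char1 k (- x) * char1 k x = 1 by rewrite -char1D addNr char1_0.
move=> /(congr1 ( *%R^~ (char1 k x)^*%C))/=.
by rewrite mul1r -mulrA -sqmodE sqmod_char1 mulr1.
Qed.

Lemma char1_orthogonal x : x != 0 -> \sum_k char1 k x = 0.
Proof.
move=> x0; pose z := w ^+ x.
rewrite (eq_bigr (fun k : 'Z_m => z ^+ k)) => [|k _]; last first.
  by rewrite /char1 mulnC exprM.
have z1 : z - 1 != 0.
  rewrite subr_eq0 /z -(prim_order_dvd w_prim); apply/negP => /dvdn_leq.
  rewrite lt0n => /(_ x0); rewrite leqNgt; have := ltn_ord x.
  by move=> ->.
apply: (mulfI z1); rewrite mulr0 -subrX1.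
by rewrite /z -exprM mulnC exprM (prim_expr_order w_prim) expr1n subrr.
Qed.

Lemma sqmod_torus_char k x : sqmod (torus_char k x) = 1.
Proof.
rewrite /torus_char (big_morph _ (@sqmodM R) (@sqmod1 R)) big1// => i _.
exact: sqmod_char1.
Qed.

Lemma torus_charD k x y :
  torus_char k (x + y) = torus_char k x * torus_char k y.
Proof.
by rewrite -big_split; apply: eq_bigr => i _; rewrite ffunE char1D.
Qed.

Lemma torus_char_orthogonal x : x != 0 -> \sum_k torus_char k x = 0.
Proof.
move=> x0; have [i xi] : exists i, x i != 0.
  apply/existsP; rewrite -negb_forall; apply: contra x0 => /forallP h.
  by apply/eqP/ffunP => i; rewrite ffunE; exact/eqP/h.
rewrite -(bigA_distr_bigA (fun i k => char1 k (x i)))/=.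
by rewrite (bigD1 i)//= char1_orthogonal// mul0r.
Qed.

Lemma fourier_uniform_box (K : finType) (t : K -> 'Z_m) k :
  fourier torus_char (uniform_weight R
    (fun g : {ffun 'I_d -> K} => [ffun i => t (g i)] : torus d m)) k =
  \prod_i ((\sum_j char1 (k i) (t j)) / #|K|%:R).
Proof.
rewrite fourier_uniform big_split/= bigA_distr_bigA/=; congr (_ * _).
  by apply: eq_bigr => g _; apply: eq_bigr => i _; rewrite ffunE.
by rewrite prodr_const card_ffun card_ord natrX exprVn.
Qed.

Definition cube_weight N : torus d m -> R :=
  uniform_weight R (fun g : {ffun 'I_d -> 'I_N.*2.+1} =>
    [ffun i => (g i)%:R - N%:R] : torus d m).

Definition dyadic_weight n : torus d m -> R :=
  uniform_weight R (fun g : {ffun 'I_d -> 'I_(2 ^ n) * 'I_(2 ^ n)} =>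
    [ffun i => (g i).1%:R - (g i).2%:R] : torus d m).

Lemma fourier_cube_weight N k : fourier torus_char (cube_weight N) k =
  ((cube_symbol (fun i => char1 (k i) 1) N)%:C)%C.
Proof.
rewrite (fourier_uniform_box (fun j : 'I_N.*2.+1 => j%:R - N%:R)).
rewrite rmorph_prod; apply: eq_bigr => i _ /=.
under eq_bigr do rewrite char1D char1N !char1_nat rmorphXn/=.
rewrite cube_symbol1E ?sqmod_char1// card_ord rmorphM/= rmorph_nat mulfK//.
Qed.

Lemma fourier_dyadic_weight n k : fourier torus_char (dyadic_weight n) k =
  ((dyadic_symbol (fun i => char1 (k i) 1) n)%:C)%C.
Proof.
rewrite (fourier_uniform_box (fun j : 'I_(2 ^ n) * 'I_(2 ^ n) => j.1%:R - j.2%:R)).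
rewrite rmorph_prod; apply: eq_bigr => i _ /=.
under eq_bigr do rewrite char1D char1N !char1_nat rmorphXn/=.
rewrite -(pair_bigA _ (fun a b : 'I_(2 ^ n) =>
  char1 (k i) 1 ^+ a * ((char1 (k i) 1)^*)%C ^+ b))/=.
rewrite card_prod card_ord natrM -expr2 /fejer (rmorphM (real_complex R)).
rewrite (fmorphV (real_complex R)) (rmorphXn (real_complex R)) rmorph_nat/=.
congr (_ / _); rewrite sqmodE raddf_sum mulr_suml; apply: eq_bigr => a _.
by rewrite mulr_sumr; apply: eq_bigr => b _; congr (_ * _); rewrite -rmorphXn.
Qed.

End TorusCharacters.

Lemma prob_cube_weight (R : realType) d m N : prob_weight (@cube_weight R d m N).
Proof. by apply: prob_uniform_weight; rewrite card_ffun !card_ord expn_gt0. Qed.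

Lemma prob_dyadic_weight (R : realType) d m n :
  prob_weight (@dyadic_weight R d m n).
Proof.
apply: prob_uniform_weight.
by rewrite card_ffun card_prod !card_ord expn_gt0 muln_gt0 expn_gt0.
Qed.

Lemma cube_dyadic_l2 (R : realType) d n0 J (N : nat -> nat) k
    (f : torus d (2 ^ n0.+1) -> R) :
  (forall n, (2 ^ n <= N n < 2 ^ n.+1)%N) ->
  \sum_x \sum_(i : 'I_J * 'I_J | ((i.1 - i.2) + (i.2 - i.1) == k)%N)
    conv (fun y => cube_weight R (N i.1) y - dyadic_weight R i.1 y)
      (conv (fun y => dyadic_weight R i.2 y - dyadic_weight R i.2.+1 y) f) x ^+ 2
    <= 1152 / 4 ^+ k * \sum_x f x ^+ 2.
Proof.
move=> NN; have [w] := primitive_root_pow2 R n0.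
have m1 : (1 < 2 ^ n0.+1)%N by rewrite -{1}(expn0 2) ltn_exp2l.
rewrite -{1}(Zp_cast m1) => wp.
apply: (conv_family_l2 (torus_charD wp) (sqmod_torus_char wp)
  (torus_char_orthogonal wp)) => [|xi].
  by rewrite card_ffun expn_gt0 card_ord.
rewrite (eq_bigr (fun i : 'I_J * 'I_J =>
  (cube_symbol (fun j => char1 w (xi j) 1) (N i.1) - 
   dyadic_symbol (fun j => char1 w (xi j) 1) i.1) ^+ 2 *
  (dyadic_symbol (fun j => char1 w (xi j) 1) i.2 -
   dyadic_symbol (fun j => char1 w (xi j) 1) i.2.+1) ^+ 2)) => [|i _]; last first.
  rewrite !fourierB (fourier_cube_weight wp) !(fourier_dyadic_weight wp).
  by rewrite -!rmorphB !sqmod_real.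
have := cube_dyadic_symbol_sum (fun i => sqmod_char1 wp (xi i) 1) J k NN.
by rewrite pair_big_dep.
Qed.

(** * Dyadic averages over all translates of the grid *)
Section TranslatedAverages.
Variables (R : realType) (G : finZmodType) (K : eqType) (c : nat -> G -> K).
Hypothesis c_coarser : forall n x y, c n x = c n y -> c n.+1 x = c n.+1 y.
Implicit Types f : G -> R.

(** The average over all tau of the conditional expectation for the partition
    translated by tau. *)
Definition transl_condexp n f (x : G) : R :=
  \sum_(tau : G) #|G|%:R^-1 * condexp (c n) (fun y => f (y - tau)) (x + tau).

Let G0 : 0 < #|G|%:R :> R.
Proof. by rewrite ltr0n; apply/card_gt0P; exists 0. Qed.

Let w0 (tau : G) : 0 <= #|G|%:R^-1 :> R. Proof. by rewrite invr_ge0 ltW. Qed.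

Let w1 : \sum_(tau : G) #|G|%:R^-1 = 1 :> R.
Proof. by rewrite sumr_const -[LHS]mulr_natr mulVf// gt_eqF. Qed.

Let sum_translates (F : G -> G -> R) A :
  (forall tau, \sum_x F tau x <= A) ->
  \sum_x \sum_(tau : G) #|G|%:R^-1 * F tau (x + tau) <= A.
Proof.
move=> FA; rewrite exchange_big/= -[leRHS]mul1r -[X in _ <= X * _]w1 mulr_suml.
apply: ler_sum => tau _; apply: le_trans (ler_wpM2l (w0 tau) (FA tau)).
by rewrite -mulr_sumr [X in _ <= _ * X](reindex_inj (addIr tau)).
Qed.

Let sum_translate f p tau : \sum_x f (x - tau) `^ p = \sum_x f x `^ p.
Proof. by rewrite [RHS](reindex_inj (addIr (- tau))). Qed.

(** The maximal function of a mean is at most the mean of the maximal functions,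
    so that the bound for each translate passes to the mean by convexity. *)
Lemma transl_condexp_maximal p f k : 1 < p -> (forall x, 0 <= f x) ->
  \sum_x (\big[Num.max/0]_(j < k) transl_condexp j f x) `^ p <=
    2 * (2 * (p / (p - 1))) `^ p * \sum_x f x `^ p.
Proof.
move=> p1 f0.
pose M tau y := \big[Num.max/0]_(j < k) condexp (c j) (fun y => f (y - tau)) y.
have M0 tau y : 0 <= M tau y.
  exact: (bigmax_ge0 k (fun j => condexp (c j) (fun y => f (y - tau)) y)).
apply: (@le_trans _ _ (\sum_x \sum_(tau : G) #|G|%:R^-1 * M tau (x + tau) `^ p)).
  apply: ler_sum => x _.
  apply: le_trans (wsum_jensen w0 w1 p1 (fun tau => M0 tau (x + tau))).
  apply: powR_le; first by rewrite ltW// (lt_trans ltr01).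
    exact: (bigmax_ge0 k (fun j => transl_condexp j f x)).
  apply: (@bigmax_leP _ k (fun j => transl_condexp j f x)) => [|j jk].
    by apply: sumr_ge0 => tau _; rewrite mulr_ge0.
  apply: ler_sum => tau _; rewrite ler_wpM2l//.
  exact: (le_bigmax_nat (fun j => condexp (c j) (fun y => f (y - tau)) (x + tau))).
apply: (sum_translates (F := fun tau x => M tau x `^ p)) => tau.
by rewrite -(sum_translate f p tau); apply: doob_maximal.
Qed.

(** The Cauchy-Schwarz inequality over the translates, with the maximal functions
    M as weights: a squared mean of differences is at most the product of the
    mean of the squares times M ^ (q - 2), which the weighted square function
    controls, and the mean of M ^ (2 - q). *)
Lemma transl_condexp_square_function q f J : 1 < q < 2 -> (forall x, 0 <= f x) ->
  \sum_x (\sum_(j < J) (transl_condexp j f x - transl_condexp j.+1 f x) ^+ 2)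
      `^ (q / 2) <=
    (4 / (q * (q - 1)) + 2 * (2 * (q / (q - 1))) `^ q) * \sum_x f x `^ q.
Proof.
move=> q12 f0; have /andP[q1 q2] := q12.
pose E j tau y := condexp (c j) (fun y => f (y - tau)) y.
pose M tau y := \big[Num.max/0]_(j < J.+1) E j tau y.
pose D j tau y := E j tau y - E j.+1 tau y.
have M0 tau y : 0 <= M tau y by exact: (bigmax_ge0 J.+1 (fun j => E j tau y)).
have ME j tau y : (j < J.+1)%N -> 0 <= E j tau y <= M tau y.
  move=> jJ; rewrite condexp_ge0//=.
  exact: (le_bigmax_nat (fun j => E j tau y)).
pose A tau y := M tau y `^ (q - 2) * \sum_(j < J) D j tau y ^+ 2.
have A0 tau y : 0 <= A tau y.
  by rewrite mulr_ge0 ?powR_ge0// sumr_ge0// => j _; exact: sqr_ge0.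
have qq1 : 1 < q / (2 - q) by rewrite ltr_pdivlMr; lra.
apply: (@le_trans _ _ (\sum_x ((\sum_(tau : G) #|G|%:R^-1 * A tau (x + tau)) +
    (\sum_(tau : G) #|G|%:R^-1 * M tau (x + tau) `^ q)))); last first.
  rewrite big_split/= mulrDl lerD//.
    apply: (sum_translates (F := A)) => tau; rewrite -(sum_translate f q tau).
    exact: condexp_square_function.
  apply: (sum_translates (F := fun tau x => M tau x `^ q)) => tau.
  by rewrite -(sum_translate f q tau); apply: doob_maximal.
apply: ler_sum => x _.
pose U := \sum_(tau : G) #|G|%:R^-1 * M tau (x + tau) `^ (2 - q).
pose V := \sum_(tau : G) #|G|%:R^-1 * A tau (x + tau).
have U0 : 0 <= U by apply: sumr_ge0 => tau _; rewrite mulr_ge0 ?powR_ge0.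
have V0 : 0 <= V by apply: sumr_ge0 => tau _; rewrite mulr_ge0.
apply: (@le_trans _ _ ((U * V) `^ (q / 2))); last first.
  apply: (le_trans (powR_half_mul q12 U0 V0)); rewrite lerD2l.
  apply: le_trans (wsum_jensen w0 w1 qq1 _) _ => [tau|]; first exact: powR_ge0.
  rewrite le_eqVlt; apply/orP; left; apply/eqP; apply: eq_bigr => tau _.
  by rewrite -powRrM [(2 - q) * _]mulrC divfK// subr_eq0 gt_eqF.
apply: powR_le; first by lra.
  by apply: sumr_ge0 => j _; exact: sqr_ge0.
have VE : V = \sum_(j < J) \sum_(tau : G)
    #|G|%:R^-1 * (D j tau (x + tau) * M tau (x + tau) `^ ((q - 2) / 2)) ^+ 2.
  rewrite exchange_big/=; apply: eq_bigr => tau _; rewrite -mulr_sumr.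
  congr (_ * _); rewrite /A mulr_sumr; apply: eq_bigr => j _.
  by rewrite exprMn mulrC -[X in _ = _ * X]powR_mulrn ?powR_ge0// -powRrM divfK.
rewrite VE mulr_sumr; apply: ler_sum => j _.
rewrite mulrC /U.
have -> : \sum_(tau : G) #|G|%:R^-1 * M tau (x + tau) `^ (2 - q) =
    \sum_(tau : G) #|G|%:R^-1 * (M tau (x + tau) `^ ((2 - q) / 2)) ^+ 2.
  by apply: eq_bigr => tau _; rewrite -powR_mulrn ?powR_ge0// -powRrM divfK.
apply: le_trans (wsum_cauchy_schwarz w0 _ _).
rewrite -sumrB le_eqVlt; apply/orP; left; apply/eqP; congr (_ ^+ 2).
apply: eq_bigr => tau _; rewrite -mulrBr -/(D j tau (x + tau)); congr (_ * _).
have /andP[a1 a2] := ME j tau (x + tau) (ltnW (ltn_ord j)).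
have /andP[b1 b2] := ME j.+1 tau (x + tau) (ltn_ord j).
have [Mt|Mt] := eqVneq (M tau (x + tau)) 0.
  rewrite Mt in a2 b2.
  have -> : D j tau (x + tau) = 0.
    rewrite /D (le_anti (introT andP (conj a2 a1))).
    by rewrite (le_anti (introT andP (conj b2 b1))) subrr.
  by rewrite !mul0r.
rewrite -mulrA -powRD ?Mt ?implybT//.
by rewrite -mulrDl addrA subrK subrr mul0r powRr0 mulr1.
Qed.

End TranslatedAverages.

Section DyadicTorus.
Variables (R : realType) (d J : nat).
Local Notation m := (2 ^ J.+1)%N.
Local Notation G := (torus d m).

Definition dyadic_cell n (x : G) : {ffun 'I_d -> nat} := [ffun i => x i %/ 2 ^ n]%N.

Lemma dyadic_cell_coarser n x y :
  dyadic_cell n x = dyadic_cell n y -> dyadic_cell n.+1 x = dyadic_cell n.+1 y.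
Proof.
move=> /ffunP e; apply/ffunP => i; have := e i; rewrite !ffunE => ei.
have divE k : (k %/ 2 ^ n.+1 = k %/ 2 ^ n %/ 2)%N by rewrite expnSr divnMA.
by rewrite !divE ei.
Qed.

Let m1 : (1 < m)%N. Proof. by rewrite -{1}(expn0 2) ltn_exp2l. Qed.

Section Level.
Variable n : nat.
Hypothesis nJ : (n <= J.+1)%N.
Local Notation K := {ffun 'I_d -> 'I_(2 ^ (J.+1 - n))}.
Local Notation B := {ffun 'I_d -> 'I_(2 ^ n)}.

Let Kval : (2 ^ (J.+1 - n) * 2 ^ n)%N = m.
Proof. by rewrite -expnD subnK. Qed.

Let n0 : (0 < 2 ^ n)%N. Proof. by rewrite expn_gt0. Qed.

Definition cell_point (g : K * B) : G :=
  [ffun i => (g.1 i * 2 ^ n + g.2 i)%N%:R].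

Let cell_pointE g i : cell_point g i = (g.1 i * 2 ^ n + g.2 i)%N :> nat.
Proof.
rewrite ffunE val_Zp_nat// modn_small// -Kval.
have a := ltn_ord (g.1 i); have b := ltn_ord (g.2 i).
apply: (@leq_trans ((g.1 i).+1 * 2 ^ n)); last by rewrite leq_mul2r a orbT.
by rewrite mulSn addnC ltn_add2r.
Qed.

Lemma dyadic_cell_point g : dyadic_cell n (cell_point g) = [ffun i => g.1 i : nat].
Proof.
apply/ffunP => i; rewrite [LHS]ffunE [RHS]ffunE cell_pointE.
by rewrite divnMDl// divn_small ?addn0.
Qed.

Lemma cell_point_bij : bijective cell_point.
Proof.
have inj : injective cell_point.
  move=> g h e.
  have e1 : g.1 = h.1.
    apply/ffunP => i; apply: val_inj.
    by have := congr1 (dyadic_cell n) e;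
      rewrite !dyadic_cell_point => /ffunP/(_ i); rewrite !ffunE.
  have e2 : g.2 = h.2.
    apply/ffunP => i; apply: val_inj.
    have := congr1 (fun x : G => x i : nat) e; rewrite /= !cell_pointE e1.
    exact: addnI.
  by case: g h e1 e2 {e} => [a b] [a' b'] /= -> ->.
apply: inj_card_bij => //.
by rewrite card_prod !card_ffun !card_ord -expnMn Kval Zp_cast.
Qed.

Lemma sum_dyadic_cell (V : nmodType) (F : G -> V) g :
  \sum_(y | dyadic_cell n y == dyadic_cell n (cell_point g)) F y =
  \sum_(b : B) F (cell_point (g.1, b)).
Proof.
rewrite (reindex cell_point)/=; last exact/onW_bij/cell_point_bij.
rewrite (eq_bigl (fun h : K * B => (h.1 == g.1) && true)) => [|h]; last first.
  rewrite !dyadic_cell_point andbT; apply/eqP/eqP => [/ffunP e|->//].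
  by apply/ffunP => i; have := e i; rewrite !ffunE => /val_inj.
rewrite (eq_bigr (fun h : K * B => F (cell_point (h.1, h.2)))) => [|[]//].
rewrite -(pair_big (pred1 g.1) xpredT (fun k b => F (cell_point (k, b))))/=.
by rewrite big_pred1_eq.
Qed.

Lemma condexp_dyadic (f : G -> R) g :
  condexp (dyadic_cell n) f (cell_point g) =
  (\sum_(b : B) f (cell_point (g.1, b))) / #|B|%:R.
Proof.
rewrite /condexp sum_dyadic_cell; congr (_ / _%:R).
by rewrite -sum1_card sum_dyadic_cell sum1_card.
Qed.

Let delta (a b : B) : G := [ffun i => (a i)%:R - (b i)%:R].

Let sub_cell_point k a b : cell_point (k, a) - cell_point (k, b) = delta a b.
Proof. by apply/ffunP => i; rewrite !ffunE !natrD opprD addrACA subrr add0r. Qed.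

Let sum_pairs (F : B -> B -> R) :
  \sum_(g : {ffun 'I_d -> 'I_(2 ^ n) * 'I_(2 ^ n)})
     F [ffun i => (g i).1] [ffun i => (g i).2] = \sum_a \sum_b F a b.
Proof.
rewrite pair_bigA/= (reindex (fun p : B * B => [ffun i => (p.1 i, p.2 i)]))/=.
  by apply: eq_bigr => -[a b] _ /=; congr F; apply/ffunP => i; rewrite !ffunE.
exists (fun g => ([ffun i => (g i).1], [ffun i => (g i).2])) => [[a b]|g] _ /=.
  by congr pair; apply/ffunP => i; rewrite !ffunE.
by apply/ffunP => i; rewrite !ffunE; case: (g i).
Qed.

(** For a random translate of the grid, the position of a given point inside its
    cube is uniformly distributed, and so is, independently, the other point of
    the cube at which f is evaluated: their difference is the difference of two
    independent uniform points of the cube. *)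
Lemma conv_dyadic_weight (f : G -> R) x :
  conv (dyadic_weight R n) f x = transl_condexp dyadic_cell n f x.
Proof.
have K0 : #|K|%:R != 0 :> R by rewrite pnatr_eq0 card_ffun card_ord -lt0n !expn_gt0.
have B0 : #|B|%:R != 0 :> R by rewrite pnatr_eq0 card_ffun card_ord -lt0n !expn_gt0.
have GE : #|G|%:R = #|K|%:R * #|B|%:R :> R.
  by rewrite -natrM -card_prod (bij_eq_card cell_point_bij).
rewrite conv_uniform /transl_condexp.
transitivity ((\sum_a \sum_b f (x - delta a b)) / (#|B|%:R * #|B|%:R)).
  rewrite -(sum_pairs (fun a b => f (x - delta a b))); congr (_ / _).
    apply: eq_bigr => g _; congr (f (_ - _)).
    by apply/ffunP => i; rewrite !ffunE.
  by rewrite -natrM !card_ffun card_prod !card_ord expnMn.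
rewrite [RHS](reindex_inj (addIr (- x)))/=.
rewrite [RHS](reindex cell_point)/=; last exact/onW_bij/cell_point_bij.
rewrite (eq_bigr (fun h : K * B => (#|G|%:R^-1 / #|B|%:R) *
    \sum_b f (x - delta h.2 b))) => [|[k a] _].
  rewrite -(pair_bigA _ (fun k a => (#|G|%:R^-1 / #|B|%:R) *
    \sum_b f (x - delta a b)))/= sumr_const -[RHS]mulr_natl -mulr_sumr GE.
  by field; rewrite K0 B0.
rewrite subrKC condexp_dyadic mulrAC -mulrA; congr (_ * _).
congr (_ / _); apply: eq_bigr => b _; congr f.
by rewrite -(sub_cell_point k) !opprB addrCA.
Qed.

End Level.

Lemma conv_dyadic_weight0 (f : G -> R) x : conv (dyadic_weight R 0) f x = f x.
Proof.
rewrite conv_uniform (eq_bigr (fun=> f x)) => [|g _].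
  rewrite sumr_const -[f x *+ _]mulr_natr mulfK// pnatr_eq0 -lt0n.
  by rewrite card_ffun card_prod !card_ord expn_gt0.
congr f; rewrite -[RHS]subr0; congr (_ - _); apply/ffunP => i; rewrite !ffunE.
by rewrite (ord1 (g i).1) (ord1 (g i).2) subrr.
Qed.

(** At the top level, the whole torus is a single cell. *)
Lemma conv_dyadic_weight_top (f : G -> R) x y :
  conv (dyadic_weight R J.+1) f x = conv (dyadic_weight R J.+1) f y.
Proof.
have top z : dyadic_cell J.+1 z = 0 :> {ffun 'I_d -> nat}.
  apply/ffunP => i; rewrite !ffunE divn_small//.
  by have := ltn_ord (z i); rewrite [X in (_ < X)%N -> _]Zp_cast.
rewrite !conv_dyadic_weight// /transl_condexp; apply: eq_bigr => tau _.
by congr (_ * _); apply: condexp_cells_constant; rewrite !top.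
Qed.

Lemma dyadic_weight_maximal p (f : G -> R) k : (k <= J.+2)%N -> 1 < p ->
  (forall x, 0 <= f x) ->
  \sum_x (\big[Num.max/0]_(j < k) conv (dyadic_weight R j) f x) `^ p <=
    2 * (2 * (p / (p - 1))) `^ p * \sum_x f x `^ p.
Proof.
move=> kJ p1 f0.
apply: le_trans (transl_condexp_maximal dyadic_cell_coarser k p1 f0).
rewrite le_eqVlt; apply/orP; left; apply/eqP; apply: eq_bigr => x _.
congr (_ `^ _); apply: eq_bigr => j _; rewrite conv_dyadic_weight//.
by rewrite -ltnS (leq_trans _ kJ).
Qed.

Lemma dyadic_weight_square_function q (f : G -> R) : 1 < q < 2 ->
  (forall x, 0 <= f x) ->
  \sum_x (\sum_(j < J.+1) (conv (fun y => dyadic_weight R j y -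
       dyadic_weight R j.+1 y) f x) ^+ 2) `^ (q / 2) <=
    (4 / (q * (q - 1)) + 2 * (2 * (q / (q - 1))) `^ q) * \sum_x f x `^ q.
Proof.
move=> q12 f0.
apply: le_trans (transl_condexp_square_function dyadic_cell_coarser J.+1 q12 f0).
rewrite le_eqVlt; apply/orP; left; apply/eqP; apply: eq_bigr => x _.
congr (_ `^ _); apply: eq_bigr => j _; rewrite convBl !conv_dyadic_weight//.
exact: ltnW.
Qed.

End DyadicTorus.

(** * The part of the comparison at a given distance between scales *)
Lemma sqrB_le (R : realDomainType) (u v : R) :
  (u - v) ^+ 2 <= 2 * (u ^+ 2 + v ^+ 2).
Proof. by have := sqr_ge0 (u + v); lra. Qed.

Section Bootstrap.
Variable R : realType.

Definition dyadic_scales (N : nat -> nat) :=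
  forall n, (2 ^ n <= N n < 2 ^ n.+1)%N.

(** One cube average for each dyadic scale, with a constant that depends neither
    on the dimension, nor on the torus, nor on the choice of the averages. *)
Definition cube_maximal_bound (p C : R) := forall d J N, dyadic_scales N ->
  forall f : torus d (2 ^ J.+1) -> R, (forall x, 0 <= f x) ->
  \sum_x (\big[Num.max/0]_(n < J.+1) conv (cube_weight R (N n)) f x) `^ p <=
    C * \sum_x f x `^ p.

(** By convexity, the p-th power of an average of f is at most the p0-th power of
    the average of f ^ (p / p0). *)
Lemma cube_maximal_bound_le p0 p C : 0 < p0 -> p0 <= p ->
  cube_maximal_bound p0 C -> cube_maximal_bound p C.
Proof.
move=> p00; rewrite le_eqVlt => /predU1P[<-//|p0p] b d J N NN f f0.
have pp0 : p / p0 * p0 = p by rewrite divfK// gt_eqF.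
have r1 : 1 < p / p0 by rewrite ltr_pdivlMr// mul1r.
have := b d J N NN (fun x => f x `^ (p / p0)) (fun x => powR_ge0 _ _).
under [X in _ <= _ * X]eq_bigr do rewrite -powRrM pp0.
apply: le_trans; apply: ler_sum => x _.
rewrite -{1}pp0 powRrM; apply: powR_le; [exact: ltW|exact: powR_ge0|].
have M0 := bigmax_ge0 J.+1 (fun n => conv (cube_weight R (N n)) f x).
have r0 : 0 <= p / p0 by rewrite ltW// (lt_trans ltr01).
have pick : \big[Num.max/0]_(n < J.+1) conv (cube_weight R (N n)) f x = 0 \/
   exists n : 'I_J.+1, \big[Num.max/0]_(n < J.+1) conv (cube_weight R (N n)) f x =
     conv (cube_weight R (N n)) f x.
  elim/big_ind: _ => [|a b' [->|[n ->]] [->|[n' ->]]|n _]; rewrite ?maxxx;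
    [by left|by left| | | |by right; exists n].
  - rewrite /Num.max; case: ifP => _; [by right; exists n'|by left].
  - rewrite /Num.max; case: ifP => _; [by left|by right; exists n].
  - rewrite /Num.max; case: ifP => _; [by right; exists n'|by right; exists n].
case: pick => [->|[n ->]].
  rewrite powR0; last by rewrite gt_eqF// (lt_trans ltr01).
  exact: (bigmax_ge0 J.+1 (fun n => conv (cube_weight R (N n)) (fun x =>
    f x `^ (p / p0)) x)).
apply: (le_trans (conv_jensen (prob_cube_weight R d _ (N n)) x r1 f0)).
exact: (le_bigmax_nat (fun n => conv (cube_weight R (N n)) (fun x =>
  f x `^ (p / p0)) x)).
Qed.

Section Torus.
Variables (d J : nat) (N : nat -> nat).
Hypothesis NN : dyadic_scales N.
Local Notation G := (torus d (2 ^ J.+1)).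
Implicit Types f : G -> R.

Definition cube_dyadic_diff n f : G -> R :=
  conv (fun y => cube_weight R (N n) y - dyadic_weight R n y) f.

Definition dyadic_diff j f : G -> R :=
  conv (fun y => dyadic_weight R j y - dyadic_weight R j.+1 y) f.

(** The part of the decomposition of all differences along the dyadic
    differences that compares scales at distance k. *)
Definition square_at k f (x : G) : R :=
  \sum_(i : 'I_J.+1 * 'I_J.+1 | ((i.1 - i.2) + (i.2 - i.1) == k)%N)
    cube_dyadic_diff i.1 (dyadic_diff i.2 f) x ^+ 2.

Lemma square_at_ge0 k f x : 0 <= square_at k f x.
Proof. by apply: sumr_ge0 => i _; exact: sqr_ge0. Qed.

Lemma square_at_l2 k f :
  \sum_x square_at k f x <= 1152 / 4 ^+ k * \sum_x f x ^+ 2.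
Proof. exact: cube_dyadic_l2. Qed.

Lemma square_atD k f g x :
  square_at k (fun y => f y + g y) x <=
    2 * (square_at k f x + square_at k g x).
Proof.
rewrite -big_split mulr_sumr/=; apply: ler_sum => i _.
rewrite [cube_dyadic_diff _ _ _](_ : _ =
    cube_dyadic_diff i.1 (dyadic_diff i.2 f) x +
    cube_dyadic_diff i.1 (dyadic_diff i.2 g) x); last first.
  by rewrite /cube_dyadic_diff -convD; apply: eq_conv => y; exact: convD.
by rewrite -subr_ge0 (_ : _ - _ =
  (cube_dyadic_diff i.1 (dyadic_diff i.2 f) x -
   cube_dyadic_diff i.1 (dyadic_diff i.2 g) x) ^+ 2) ?sqr_ge0//; ring.
Qed.

(** The maximal inequality at q / (2 - q) bounds the vector-valued averages on
    L^q, and the square function of the dyadic averages then bounds the vector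
    to which they are applied. There is no decay in k yet. *)
Lemma square_at_bound (q C : R) k f : 1 < q < 2 -> 0 <= C ->
  cube_maximal_bound (q / (2 - q)) C -> (forall x, 0 <= f x) ->
  \sum_x square_at k f x `^ (q / 2) <=
    4 * (2 + C + 2 * (2 * (q / (2 - q) / (q / (2 - q) - 1))) `^ (q / (2 - q))) *
    (4 / (q * (q - 1)) + 2 * (2 * (q / (q - 1))) `^ q) * \sum_x f x `^ q.
Proof.
move=> q12 C0 hC f0; have /andP[q1 q2] := q12.
have t01 : 0 < q / 2 <= 1 by apply/andP; split; lra.
have t0 : 0 <= q / 2 by lra.
have two (y : R) : 0 <= y -> (2 * y) `^ (q / 2) <= 2 * y `^ (q / 2).
  by move=> y0; rewrite powRM// ler_wpM2r ?powR_ge0// ler1_powR// ?ler1n//; lra.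
set p0 := q / (2 - q) in hC *; have p01 : 1 < p0 by rewrite ltr_pdivlMr; lra.
set CD := 2 * (2 * (p0 / _)) `^ p0; set CS := 4 / (q * _) + _.
pose P := fun i : 'I_J.+1 * 'I_J.+1 => ((i.1 - i.2) + (i.2 - i.1) == k)%N.
pose g (i : 'I_J.+1 * 'I_J.+1) x := if P i then dyadic_diff i.2 f x else 0.
pose UA (h : G -> R) (x :
  G) := \big[Num.max/0]_(n < J.+1) conv (cube_weight R (N n)) h x.
pose UP (h : G -> R) (x :
  G) := \big[Num.max/0]_(n < J.+1) conv (dyadic_weight R n) h x.
have vA := @conv_square_sum R G q C ('I_J.+1 * 'I_J.+1)%type
  (fun i => cube_weight R (N i.1)) UA g q12
  (fun i => prob_cube_weight R d _ (N i.1))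
  (fun h x => bigmax_ge0 J.+1 (fun n => conv (cube_weight R (N n)) h x))
  (fun i h x _ => le_bigmax_nat (fun n =>
    conv (cube_weight R (N n)) h x) (ltn_ord i.1))
  (hC d J N NN).
have vP := @conv_square_sum R G q CD ('I_J.+1 * 'I_J.+1)%type
  (fun i => dyadic_weight R i.1) UP g q12
  (fun i => prob_dyadic_weight R d _ i.1)
  (fun h x => bigmax_ge0 J.+1 (fun n => conv (dyadic_weight R n) h x))
  (fun i h x _ => le_bigmax_nat (fun n =>
    conv (dyadic_weight R n) h x) (ltn_ord i.1))
  (fun h => dyadic_weight_maximal (leqnSn J.+1) p01).
have step1 : \sum_x square_at k f x `^ (q / 2) <=
    2 * (\sum_x (\sum_(i :
      'I_J.+1 * 'I_J.+1) conv (cube_weight R (N i.1)) (g i) x ^+ 2) `^ (q / 2) +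
         \sum_x (\sum_(i : 'I_J.+1 * 'I_J.+1) conv (dyadic_weight R i.1) (g i)
           x ^+ 2) `^ (q / 2)).
  rewrite -big_split mulr_sumr/=; apply: ler_sum => x _.
  set a := \sum_i conv (cube_weight _ _) _ _ ^+ 2.
  set b := \sum_i conv (dyadic_weight _ _) _ _ ^+ 2.
  have a0 : 0 <= a by apply: sumr_ge0 => i _; exact: sqr_ge0.
  have b0 : 0 <= b by apply: sumr_ge0 => i _; exact: sqr_ge0.
  apply: (@le_trans _ _ ((2 * (a + b)) `^ (q / 2))).
    apply: powR_le => //; first exact: square_at_ge0.
    rewrite /square_at big_mkcond -big_split mulr_sumr; apply: ler_sum => i _ /=.
    rewrite -/(P i); case: ifP => Pi; last by rewrite mulr_ge0// addr_ge0 ?sqr_ge0.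
    rewrite /cube_dyadic_diff convBl.
    rewrite (@eq_conv _ _ (cube_weight R (N i.1)) (g i) (dyadic_diff i.2 f)) =>
      [|y]; last by rewrite /g Pi.
    rewrite (@eq_conv _ _ (dyadic_weight R i.1) (g i) (dyadic_diff i.2 f)) =>
      [|y]; last by rewrite /g Pi.
    exact: sqrB_le.
  apply: (le_trans (two _ (addr_ge0 a0 b0))).
  by rewrite ler_wpM2l// powR_subadd.
have step2 : \sum_x (\sum_(i :
  'I_J.+1 * 'I_J.+1) g i x ^+ 2) `^ (q / 2) <= 2 * (CS * \sum_x f x `^ q).
  have := dyadic_weight_square_function q12 f0.
  rewrite -/CS => h; apply: le_trans (ler_wpM2l _ h) => //.
  rewrite mulr_sumr; apply: ler_sum => x _.
  have s0 : 0 <= \sum_(j < J.+1) dyadic_diff j f x ^+ 2.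
    by apply: sumr_ge0 => i _; exact: sqr_ge0.
  apply: le_trans (two _ s0); apply: powR_le => //.
    by apply: sumr_ge0 => i _; exact: sqr_ge0.
  rewrite (eq_bigr (fun i =>
    if P i then dyadic_diff i.2 f x ^+ 2 else 0)) => [|i _]; last first.
    by rewrite /g; case: ifP => _//; rewrite expr0n.
  rewrite -big_mkcond/=.
  rewrite -(pair_big_dep xpredT (fun n j : 'I_J.+1 => ((n - j) + (j - n) == k)%N)
    (fun n j : 'I_J.+1 => dyadic_diff j f x ^+ 2))/=.
  rewrite (exchange_big_dep xpredT)//= mulr_sumr; apply: ler_sum => j _.
  by apply: sum_dist_eq_le; exact: sqr_ge0.
apply: (le_trans step1); set F := \sum_x f x `^ q in step2 *.
set X := \sum_x _ in step2 vA vP *.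
have CD0 : 0 <= CD by rewrite mulr_ge0 ?powR_ge0.
rewrite [leRHS](_ : _ =
  2 * ((1 + C) * (2 * (CS * F)) + (1 + CD) * (2 * (CS * F)))); last by ring.
rewrite ler_wpM2l// lerD//.
  by apply: (le_trans vA); rewrite ler_wpM2l// addr_ge0.
by apply: (le_trans vP); rewrite ler_wpM2l// addr_ge0.
Qed.

End Torus.
End Bootstrap.

(** * The maximal inequality on the torus *)
Section DecayToMaximal.
Variable R : realType.

Definition square_decay (p C rho : R) := forall d J N, dyadic_scales N ->
  forall k (f : torus d (2 ^ J.+1) -> R), (forall x, 0 <= f x) ->
  \sum_x square_at N k f x `^ (p / 2) <=
    C * (rho ^+ 2) ^+ k * \sum_x f x `^ p.

Lemma square_decay2 : square_decay 2 1152 2^-1.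
Proof.
move=> d J N NN k f f0; have := square_at_l2 NN k f.
have -> : \sum_x square_at N k f x `^ (2 / 2) = \sum_x square_at N k f x.
  by apply: eq_bigr => x _; rewrite divff// powRr1// square_at_ge0.
have -> : \sum_x f x `^ 2 = \sum_x f x ^+ 2.
  by apply: eq_bigr => x _; rewrite powR_mulrn.
have -> : 2^-1 ^+ 2 = 4^-1 :> R by rewrite exprVn -natrX.
by rewrite exprVn.
Qed.

(** At the exponent 2 the constant is of order 4 ^ (- k); cutting at
    gam = 2 ^ (k / (2 - p)) costs half of this decay and creates decay in the
    term which comes from the exponent q. *)
Lemma square_decay_interpolate (q p C : R) : 1 < q -> q < p -> p < 2 ->
  0 <= C -> cube_maximal_bound (q / (2 - q)) C ->
  exists C1 rho : R, [/\ 0 <= C1, 0 < rho < 1 & square_decay p C1 rho].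
Proof.
move=> q1 qp p2 C0 hC; have q2 : q < 2 by exact: lt_trans p2.
have q12 : 1 < q < 2 by rewrite q1.
have p1 : 1 < p by exact: lt_trans qp.
have [K K0 hK] := marcinkiewicz q1 qp p2.
have [D D0 l2] : exists2 D : R, 0 <= D & forall d J N, dyadic_scales N ->
    forall k (f : torus d (2 ^ J.+1) -> R),
    \sum_x square_at N k f x <= D / 4 ^+ k * \sum_x f x ^+ 2.
  exists 1152; [exact: ler0n|move=> d J N NN k f; exact: square_at_l2].
have [B B0 lq] : exists2 B : R, 0 <= B & forall d J N, dyadic_scales N ->
    forall k (f : torus d (2 ^ J.+1) -> R), (forall x, 0 <= f x) ->
    \sum_x square_at N k f x `^ (q / 2) <= B * \sum_x f x `^ q.
  eexists; last by move=> d J N NN k f f0;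
    exact: (square_at_bound NN k q12 C0 hC f0).
  have q0 : 0 <= q by rewrite ltW// (lt_trans _ q1).
  have q10 : 0 <= q - 1 by rewrite subr_ge0 ltW.
  apply: mulr_ge0; first apply: mulr_ge0 => //.
    by apply: addr_ge0; [exact: addr_ge0|rewrite mulr_ge0 ?powR_ge0].
  by apply: addr_ge0; [rewrite divr_ge0// mulr_ge0|rewrite mulr_ge0 ?powR_ge0].
pose s := (p - q) / (2 - p).
have s0 : 0 < s by rewrite divr_gt0 ?subr_gt0.
pose eta : R := Num.max (2 `^ (- s)) 2^-1.
have eta0 : 0 < eta by rewrite lt_max powR_gt0.
have eta1 : eta < 1.
  by rewrite gt_max powRN !invf_lt1 ?powR_gt0 ?powR_gt1//= ltr1n.
exists (K * (B + D)), (Num.sqrt eta); split.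
- by rewrite mulr_ge0 ?(ltW K0)// addr_ge0.
- by rewrite sqrtr_gt0 eta0/= -[ltRHS]sqrtr1 ltr_sqrt.
move=> d J N NN k f f0; rewrite sqr_sqrtr ?(ltW eta0)//.
pose T (g : torus d (2 ^ J.+1) -> R) x := Num.sqrt (square_at N k g x).
pose gam : R := (2 `^ (2 - p)^-1) ^+ k.
have p20 : 2 - p != 0 by rewrite subr_eq0 gt_eqF.
have gam0 : 0 < gam by rewrite exprn_gt0 ?powR_gt0.
have TE t g x : T g x `^ t = square_at N k g x `^ (t / 2).
  by rewrite /T -powR12_sqrt ?square_at_ge0// -powRrM mulrC.
have := hK _ T B (D / 4 ^+ k) gam B0 _ gam0 _ _ _ _ f f0.
under eq_bigr do rewrite TE.
move=> h; apply: le_trans (h _ _ _ _ _) _ => {h}.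
- by rewrite divr_ge0// exprn_ge0.
- by move=> g x; exact: sqrtr_ge0.
- move=> g h x; rewrite /T.
  have a0 := square_at_ge0 N k g x; have b0 := square_at_ge0 N k h x.
  apply: (@le_trans _ _ (Num.sqrt (2 * (square_at N k g x + square_at N k h x)))).
    by rewrite ler_wsqrtr// square_atD.
  move: a0 b0; set a := square_at _ _ _ _; set b := square_at _ _ _ _ => a0 b0.
  have sa := sqrtr_ge0 a; have sb := sqrtr_ge0 b.
  have ea := sqr_sqrtr a0; have eb := sqr_sqrtr b0.
  rewrite -(@ler_pXn2r _ 2) ?nnegrE ?sqrtr_ge0 ?mulr_ge0 ?addr_ge0//.
  rewrite sqr_sqrtr ?mulr_ge0 ?addr_ge0// -{1}ea -{1}eb.
  move: sa sb; set u := Num.sqrt a; set v := Num.sqrt b => u0 v0; nra.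
- by move=> g g0; under eq_bigr do rewrite TE; exact: lq.
- move=> g g0; rewrite (eq_bigr (square_at N k g)) => [|x _]; first exact: l2.
  by rewrite sqr_sqrtr ?square_at_ge0.
have gamX t : gam `^ t = (2 `^ (t / (2 - p))) ^+ k.
  by rewrite /gam -powR_mulrn ?powR_ge0// powRAC powR_mulrn ?powR_ge0// -powRrM
    [_ * t]mulrC.
rewrite ler_wpM2r ?sumr_ge0// => [x _|]; first exact: powR_ge0.
rewrite -[leRHS]mulrA ler_wpM2l ?(ltW K0)// mulrDl lerD//.
  rewrite ler_wpM2l// gamX lerXn2r ?nnegrE ?powR_ge0 ?(ltW eta0)//.
  by rewrite /eta -opprB mulNr le_max lexx.
rewrite gamX divff// powRr1// -[leLHS]mulrA ler_wpM2l//.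
rewrite -exprVn -exprMn lerXn2r ?nnegrE ?(ltW eta0) ?mulr_ge0 ?invr_ge0//.
by rewrite /eta le_max; apply/orP; right; lra.
Qed.

Section Torus.
Variables (d J : nat) (N : nat -> nat).
Local Notation G := (torus d (2 ^ J.+1)).
Implicit Types f : G -> R.

(** The dyadic differences of f add up to f minus a constant, which the
    differences between cube averages and dyadic averages annihilate. *)
Lemma cube_dyadic_diff_sum n f x :
  cube_dyadic_diff N n f x =
    \sum_(j < J.+1) cube_dyadic_diff N n (dyadic_diff j f) x.
Proof.
have e y : \sum_(j < J.+1) dyadic_diff j f y =
  f y - conv (dyadic_weight R J.+1) f y.
  rewrite -(conv_dyadic_weight0 f y).
  rewrite -(sum_diff _ (fun j => conv (dyadic_weight R j) f y)).
  by apply: eq_bigr => j _; exact: convBl.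
rewrite /cube_dyadic_diff -conv_sumr (eq_conv _ _ e) convB.
rewrite [X in _ - X](_ : _ = 0) ?subr0//.
rewrite (eq_conv _ _ (fun y => conv_dyadic_weight_top f y 0)) convBl.
rewrite (conv_cst (prob_cube_weight _ _ _ _)).
by rewrite (conv_cst (prob_dyadic_weight _ _ _ _)) subrr.
Qed.

Let dist (n j : 'I_J.+1) : nat := (n - j) + (j - n).

Let distJ n j : (dist n j < J.+1)%N.
Proof. by have := ltn_ord n; have := ltn_ord j; rewrite /dist; lia. Qed.

(** The Cauchy-Schwarz inequality with weights rho ^ |n - j|. *)
Lemma sum_cube_dyadic_diff_sqr_le (rho : R) f x : 0 < rho < 1 ->
  \sum_(n < J.+1) cube_dyadic_diff N n f x ^+ 2 <=
  2 / (1 - rho) * \sum_(k < J.+1) rho^-1 ^+ k * square_at N k f x.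
Proof.
move=> /andP[r0 r1]; have r10 : 0 < 1 - rho by rewrite subr_gt0.
pose y (n j : 'I_J.+1) := cube_dyadic_diff N n (dyadic_diff j f) x.
have geo : \sum_(k < J.+1) rho ^+ k <= (1 - rho)^-1.
  rewrite -[leRHS]mul1r;
    apply: le_trans (@geometric_sum_le_down R rho 1 1 J.+1 _ _ _); rewrite ?r0//.
  rewrite [leRHS]big_mkcond; apply: ler_sum => k _.
  by rewrite mul1r ifT// exprn_ile1 ?(ltW r0) ?(ltW r1).
have row n : \sum_(j < J.+1) rho ^+ dist n j <= 2 / (1 - rho).
  rewrite (eq_bigr (fun j =>
    \sum_(k < J.+1 | k == dist n j :> nat) rho ^+ k)) => [|j _]; last first.
    by rewrite (big_ord1_eq _ (fun k => rho ^+ k)) distJ.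
  rewrite (exchange_big_dep xpredT)//=.
  apply: le_trans (ler_wpM2l _ geo) => //; rewrite mulr_sumr; apply: ler_sum => k _.
  rewrite (eq_bigl (fun j : 'I_J.+1 => ((j - n) + (n - j) == k)%N)) => [|j].
    by apply: sum_dist_eq_le; rewrite exprn_ge0 ?(ltW r0).
  by rewrite eq_sym /dist addnC.
apply: (@le_trans _ _ (\sum_(n < J.+1) 2 / (1 - rho) *
    \sum_(j < J.+1) rho^-1 ^+ dist n j * y n j ^+ 2)).
  apply: ler_sum => n _; rewrite cube_dyadic_diff_sum.
  have w0 j : 0 <= rho ^+ dist n j by rewrite exprn_ge0 ?(ltW r0).
  have := wsum_cauchy_schwarz w0 (fun=> 1) (fun j => rho^-1 ^+ dist n j * y n j).
  have rr k : rho ^+ k * rho^-1 ^+ k = 1 by rewrite -exprMn divff ?expr1n// gt_eqF.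
  rewrite (eq_bigr (y n)) => [|j _]; last by rewrite mul1r mulrA rr mul1r.
  move=> /le_trans; apply.
  rewrite [X in X * _](eq_bigr (fun j => rho ^+ dist n j)) => [|j _]; last first.
    by rewrite expr1n mulr1.
  rewrite [X in _ * X](eq_bigr (fun j =>
    rho^-1 ^+ dist n j * y n j ^+ 2)) => [|j _]; last first.
    by rewrite exprMn [in LHS]expr2 !mulrA rr mul1r.
  rewrite ler_wpM2r// sumr_ge0// => j _.
  by rewrite mulr_ge0 ?sqr_ge0// exprn_ge0// invr_ge0 ltW.
rewrite -mulr_sumr ler_wpM2l ?divr_ge0 ?(ltW r10)//.
rewrite le_eqVlt; apply/orP; left; apply/eqP.
under [RHS]eq_bigr do rewrite /square_at mulr_sumr.
rewrite pair_bigA/= [RHS](exchange_big_dep xpredT)//=; apply: eq_bigr => i _.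
rewrite (eq_bigl (fun k : 'I_J.+1 => k == dist i.1 i.2 :> nat)) => [|k]; last first.
  by rewrite eq_sym.
by rewrite (big_ord1_eq _ (fun k =>
  rho^-1 ^+ k * cube_dyadic_diff N i.1 (dyadic_diff i.2 f) x ^+ 2)) distJ.
Qed.

Lemma cube_maximal_le f x : (forall y, 0 <= f y) ->
  \big[Num.max/0]_(n < J.+1) conv (cube_weight R (N n)) f x <=
    \big[Num.max/0]_(n < J.+1) conv (dyadic_weight R n) f x +
    (\sum_(n < J.+1) cube_dyadic_diff N n f x ^+ 2) `^ (1 / 2).
Proof.
move=> f0; have S0 : 0 <= \sum_(n < J.+1) cube_dyadic_diff N n f x ^+ 2.
  by apply: sumr_ge0 => n _; exact: sqr_ge0.
apply: (@bigmax_leP _ J.+1 (fun n => conv (cube_weight R (N n)) f x)) => [|n nJ].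
  rewrite addr_ge0 ?powR_ge0//.
  exact: (bigmax_ge0 J.+1 (fun n => conv (dyadic_weight R n) f x)).
rewrite -[leLHS](subrKC (conv (dyadic_weight R n) f x)) lerD//.
  exact: (le_bigmax_nat (fun n => conv (dyadic_weight R n) f x)).
rewrite -convBl -/(cube_dyadic_diff N n f x) mul1r powR12_sqrt//.
apply: (le_trans (ler_norm _)); rewrite -sqrtr_sqr ler_wsqrtr//.
rewrite (bigD1 (Ordinal nJ))//= lerDl sumr_ge0// => i _; exact: sqr_ge0.
Qed.

End Torus.

(** Since p / 2 <= 1, the power p / 2 of the sum over k is at most the sum of the
    powers; the losses rho ^ (- k) are absorbed by the assumed decay
    rho ^ (2 k). *)
Lemma square_decay_maximal (p C1 rho : R) : 1 < p <= 2 -> 0 <= C1 ->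
  0 < rho < 1 -> square_decay p C1 rho ->
  exists2 C : R, 0 <= C & cube_maximal_bound p C.
Proof.
move=> /andP[p1 p2] C10 r01 hd; have /andP[r0 r1] := r01.
have p0 : 0 < p by exact: lt_trans p1.
pose CD : R := 2 * (2 * (p / (p - 1))) `^ p.
pose c : R := 2 / (1 - rho).
have c0 : 0 < c by rewrite divr_gt0 ?subr_gt0.
have CD0 : 0 <= CD by rewrite mulr_ge0 ?powR_ge0.
have r10 : 0 < 1 - rho by rewrite subr_gt0.
exists (2 `^ p * (CD + c `^ (p / 2) * (C1 / (1 - rho)))).
  by rewrite mulr_ge0 ?powR_ge0// addr_ge0// mulr_ge0 ?powR_ge0// divr_ge0// ltW.
move=> d J N NN f f0.
pose MP x := \big[Num.max/0]_(n < J.+1) conv (dyadic_weight R n) f x.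
pose S x := \sum_(n < J.+1) cube_dyadic_diff N n f x ^+ 2.
have S0 x : 0 <= S x by apply: sumr_ge0 => n _; exact: sqr_ge0.
have MP0 x : 0 <= MP x by exact: (bigmax_ge0 J.+1 (fun n =>
  conv (dyadic_weight R n) f x)).
have t01 : 0 < p / 2 <= 1 by apply/andP; split; lra.
have F0 : 0 <= \sum_x f x `^ p by apply: sumr_ge0 => x _; exact: powR_ge0.
apply: (@le_trans _ _ (\sum_x 2 `^ p * (MP x `^ p + S x `^ (p / 2)))).
  apply: ler_sum => x _.
  apply: (@le_trans _ _ ((MP x + S x `^ (1 / 2)) `^ p)).
    apply: powR_le; [exact: ltW| |exact: cube_maximal_le].
    exact: (bigmax_ge0 J.+1 (fun n => conv (cube_weight R (N n)) f x)).
  apply: (le_trans (powR_addX (ltW p0) (MP0 x) (powR_ge0 _ _))).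
  by rewrite -powRrM mul1r [2^-1 * p]mulrC.
rewrite -mulr_sumr -mulrA ler_wpM2l ?powR_ge0// big_split/= mulrDl lerD//.
  exact: dyadic_weight_maximal.
apply: (@le_trans _ _ (\sum_x c `^ (p / 2) *
    \sum_(k < J.+1) rho^-1 ^+ k * square_at N k f x `^ (p / 2))).
  apply: ler_sum => x _.
  have T0 : 0 <= \sum_(k < J.+1) rho^-1 ^+ k * square_at N k f x.
    by apply: sumr_ge0 => k _;
      rewrite mulr_ge0 ?square_at_ge0// exprn_ge0// invr_ge0 ltW.
  apply: (@le_trans _ _ ((c * \sum_(k < J.+1) rho^-1 ^+ k * square_at N k f x)
    `^ (p / 2))).
    apply: powR_le; [by case/andP: t01 => /ltW|exact: S0|].
    exact: sum_cube_dyadic_diff_sqr_le.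
  rewrite powRM ?(ltW c0)// ler_wpM2l ?powR_ge0//.
  apply: (le_trans (powR_sum_le _ _ t01 _)) => [k|].
    by rewrite mulr_ge0 ?square_at_ge0// exprn_ge0// invr_ge0 ltW.
  apply: ler_sum => k _.
  rewrite powRM ?square_at_ge0 ?exprn_ge0 ?invr_ge0 ?(ltW r0)//.
  rewrite ler_wpM2r ?powR_ge0//; apply: ler1_powR; last by case/andP: t01.
  by rewrite exprn_ege1// -[leLHS]invr1 lef_pV2 ?posrE// ltW.
rewrite -mulr_sumr -mulrA ler_wpM2l ?powR_ge0// exchange_big/=.
apply: (@le_trans _ _ (\sum_(k < J.+1) C1 * rho ^+ k * \sum_x f x `^ p)).
  apply: ler_sum => k _; rewrite -mulr_sumr.
  have rk : 0 <= rho^-1 ^+ k by rewrite exprn_ge0// invr_ge0 ltW.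
  apply: (le_trans (ler_wpM2l rk (hd d J N NN k f f0))).
  rewrite mulrA ler_wpM2r// mulrCA ler_wpM2l// -exprMn expr2.
  by rewrite mulrA mulVf ?mul1r// gt_eqF.
rewrite -mulr_suml ler_wpM2r// -mulr_sumr ler_wpM2l//.
rewrite -[leRHS]mul1r;
  apply: le_trans (@geometric_sum_le_down R rho 1 1 J.+1 _ _ _); rewrite ?r0//.
rewrite [leRHS]big_mkcond; apply: ler_sum => k _.
by rewrite mul1r ifT// exprn_ile1 ?(ltW r0) ?(ltW r1).
Qed.

(** With e = 1 - 1/p, each step of the bootstrap multiplies e by 3/4; any
    factor larger than 1/2 would do. *)
Lemma cube_maximal_step (e : R) : 0 < e <= 2^-1 ->
  (exists2 C : R, 0 <= C & cube_maximal_bound (1 - e)^-1 C) ->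
  exists2 C : R, 0 <= C & cube_maximal_bound (1 - 3 / 4 * e)^-1 C.
Proof.
move=> /andP[e0 e2] [C C0 hC].
pose q := (1 - e / 2)^-1; pose p := (1 - 3 / 4 * e)^-1.
have qd : 0 < 1 - e / 2 by lra.
have pd : 0 < 1 - 3 / 4 * e by lra.
have q1 : 1 < q by rewrite invf_gt1//; lra.
have qp : q < p by rewrite ltf_pV2 ?posrE//; lra.
have p2 : p < 2 by rewrite invf_plt ?posrE//; lra.
have e1 : 1 - e != 0 by rewrite gt_eqF//; lra.
have qe : q / (2 - q) = (1 - e)^-1.
  have q0 : q != 0 by rewrite gt_eqF// (lt_trans ltr01).
  rewrite (_ : 2 - q = (1 - e) * q); first by rewrite invfM mulrCA divff ?mulr1.
  by rewrite /q; field; rewrite gt_eqF//; lra.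
have [C1 [rho [C10 r01 hd]]] :=
  @square_decay_interpolate q p C q1 qp p2 C0 (eq_ind_r (fun t =>
    cube_maximal_bound t C) hC qe).
apply: (square_decay_maximal _ C10 r01 hd).
by rewrite (lt_trans q1 qp)/= ltW.
Qed.

(** The bootstrap starts at p = 2, where orthogonality alone gives the decay, and
    brings 1 - 1/p as close to 0 as desired; larger exponents follow by
    convexity. *)
Theorem cube_maximal (p : R) : 1 < p ->
  exists2 C : R, 0 <= C & cube_maximal_bound p C.
Proof.
move=> p1; pose e (n : nat) : R := (3 / 4) ^+ n / 2.
have en n : 0 < e n <= 2^-1.
  rewrite /e divr_gt0 ?exprn_gt0 ?divr_gt0//= ler_piMl ?invr_ge0//.
  by rewrite exprn_ile1 ?divr_ge0//; lra.
have main n : exists2 C : R, 0 <= C & cube_maximal_bound (1 - e n)^-1 C.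
  elim: n => [|n IH].
    have -> : (1 - e 0%N)^-1 = 2 :> R by rewrite /e expr0; field.
    have p2 : 1 < (2 : R) <= 2 by rewrite ltr1n lexx.
    have r01 : 0 < (2^-1 :
      R) < 1 by rewrite invr_gt0 ltr0n/= invf_lt1 ?ltr1n ?ltr0n.
    exact: square_decay_maximal p2 (ler0n R 1152) r01 square_decay2.
  have := cube_maximal_step (en n) IH.
  by rewrite (_ : 3 / 4 * e n = e n.+1)// /e exprS mulrA.
have small n : (3 / 4 : R) ^+ n <= 4 / (n%:R + 4).
  elim: n => [|n IH]; first by rewrite expr0 add0r divff.
  rewrite exprS; apply: le_trans (ler_wpM2l _ IH) _; first lra.
  have n0 : 0 <= n%:R :> R by [].
  rewrite -natr1 ler_pdivlMr; last lra.
  rewrite mulrA mulrAC ler_pdivrMr; lra.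
have d0 : 0 < 1 - p^-1 by rewrite subr_gt0 invf_lt1// (lt_trans ltr01).
pose n := Num.bound (2 / (1 - p^-1)).
have nb : 2 / (1 - p^-1) < n%:R by apply: archi_boundP; rewrite divr_ge0// ltW.
have [C C0 hC] := main n; exists C => //.
have /andP[en0 en1] := en n.
have ne0 : 0 < 1 - e n by lra.
have pi0 : 0 < p^-1 by rewrite invr_gt0 (lt_trans ltr01).
apply: (cube_maximal_bound_le _ _ hC); first by rewrite invr_gt0.
rewrite -[leRHS]invrK lef_pV2 ?posrE//.
suff : e n <= 1 - p^-1 by lra.
rewrite /e; have n0 : 0 <= n%:R :> R by [].
apply: (@le_trans _ _ (4 / (n%:R + 4) / 2)); first by rewrite ler_wpM2r ?invr_ge0.
rewrite mulrAC ler_pdivrMr; last lra.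
move: nb; rewrite ltr_pdivrMr//; nra.
Qed.

End DecayToMaximal.

(** * From the torus to the lattice *)
Section LatticeAverages.
Variables (R : realType) (d : nat).
Implicit Types (h : lattice d -> R) (N : nat).

Definition box_point N (g : {ffun 'I_d -> 'I_N.*2.+1}) : lattice d :=
  \row_i ((g i)%:Z - N%:Z).

Definition box_average N h (x : lattice d) : R :=
  (\sum_(g : {ffun 'I_d -> 'I_N.*2.+1}) h (x - box_point g)) /
    #|{ffun 'I_d -> 'I_N.*2.+1}|%:R.

Let box_card N : 0 < #|{ffun 'I_d -> 'I_N.*2.+1}|%:R :> R.
Proof. by rewrite ltr0n card_ffun !card_ord expn_gt0. Qed.

Lemma box_average_ge0 N h x : (forall y, 0 <= h y) -> 0 <= box_average N h x.
Proof. by move=> h0; rewrite divr_ge0// sumr_ge0. Qed.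

Lemma box_average_le N h x t : (forall y, h y <= t) -> box_average N h x <= t.
Proof.
move=> ht; rewrite ler_pdivrMr//.
apply: le_trans (ler_sum _ (fun g _ => ht (x - box_point g))) _.
by rewrite sumr_const mulr_natr.
Qed.

Lemma box_average0 h x : box_average 0 h x = h x.
Proof.
rewrite /box_average (eq_bigr (fun=> h x)) => [|g _].
  by rewrite sumr_const -[h x *+ _]mulr_natr mulfK// gt_eqF.
congr h; rewrite -[RHS]subr0; congr (_ - _).
by apply/rowP => i; rewrite !mxE (ord1 (g i)) subrr.
Qed.

Lemma box_point_inj N : injective (@box_point N).
Proof.
move=> g g' /rowP e; apply/ffunP => i; apply: val_inj.
by have := e i; rewrite !mxE => /addIr [].
Qed.

Lemma sum_box_point (V : nmodType) N (F : lattice d -> V) :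
  \sum_(y \in [set box_point g | g in [set: {ffun 'I_d ->
     'I_N.*2.+1}]]%classic) F y =
  \sum_(g : {ffun 'I_d -> 'I_N.*2.+1}) F (box_point g).
Proof.
have inj : set_inj setT (@box_point N) by move=> g g' _ _ /box_point_inj.
rewrite fsbig_image// (fsbigE (index_enum {ffun 'I_d -> 'I_N.*2.+1}))//.
- by rewrite (eq_bigl xpredT)// => g; rewrite in_setT.
- by rewrite index_enum_uniq.
- by move=> g _; rewrite mem_index_enum.
Qed.

Lemma lattice_cubeE (t : R) : 0 < t ->
  lattice_cube d t = [set box_point g | g in [set: {ffun 'I_d ->
     'I_(Num.truncn t).*2.+1}]]%classic.
Proof.
move=> t0; set N := Num.truncn t.
have tN (z : int) : (- t <= z%:~R <= t) = (`|z| <= N)%N.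
  rewrite -ler_norml -intr_norm -abszE -pmulrn.
  by rewrite /N truncn_ge_nat// ltW.
apply/seteqP; split => [y yt|_ [g _ <-] i]; last first.
  rewrite mxE tN; have := ltn_ord (g i).
  lia.
exists [ffun i => inord (absz ((y : 'rV[int]_d) ord0 i + N%:Z))] => //.
apply/rowP => i; rewrite !mxE ffunE.
have := yt i; rewrite /= tN; set k := (y : 'rV[int]_d) ord0 i => kN.
by rewrite inordK; lia.
Qed.

Lemma normc_nat n : ComplexField.Normc.normc (n%:R : R[i]) = n%:R.
Proof.
rewrite -(rmorph_nat (real_complex R)) /ComplexField.Normc.normc/=.
by rewrite expr0n/= addr0 sqrtr_sqr ger0_norm.
Qed.

Lemma normc_sum (I : Type) (r : seq I) (F : I -> R[i]) :
  ComplexField.Normc.normc (\sum_(i <- r) F i) <=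
    \sum_(i <- r) ComplexField.Normc.normc (F i).
Proof.
elim: r => [|i r IH]; first by rewrite !big_nil ComplexField.Normc.normc0.
rewrite !big_cons (le_trans (le_normcD _ _))//.
by rewrite lerD2l.
Qed.

Lemma cube_average_le (t : R) (f : lattice d -> R[i]) x : 0 < t ->
  ComplexField.Normc.normc (cube_average t f x) <=
    box_average (Num.truncn t) (fun y => ComplexField.Normc.normc (f y)) x.
Proof.
move=> t0; rewrite /cube_average lattice_cubeE//.
set N := Num.truncn t.
rewrite sum_box_point.
have -> : #|` fset_set [set box_point g | g in [set: {ffun 'I_d ->
   'I_N.*2.+1}]]%classic| =
    #|{ffun 'I_d -> 'I_N.*2.+1}|.
  have := sum_box_point N (fun=> 1%N); rewrite fsbig_finite; last first.
    exact/finite_image/finite_finset.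
  by rewrite [LHS]sum1_size [RHS]sum1_card.
rewrite ComplexField.Normc.normcM ComplexField.Normc.normcV normc_nat mulrC.
by rewrite ler_wpM2r ?invr_ge0// normc_sum.
Qed.

End LatticeAverages.

Section TorusLift.
Variables (d J : nat).
Local Notation m := (2 ^ J.+1)%N.

Let m1 : (1 < m)%N. Proof. by rewrite -{1}(expn0 2) ltn_exp2l. Qed.

(** The representative of a point of the torus in the box [-2^J, 2^J)^d. *)
Definition torus_lift (u : torus d m) : lattice d :=
  \row_i ((u i : nat)%:Z - (2 ^ J)%N%:Z).

Definition torus_proj (x : lattice d) : torus d m :=
  [ffun i => ((x : 'rV[int]_d) ord0 i + (2 ^ J)%N%:Z)%:~R].

Lemma torus_lift_inj : injective torus_lift.
Proof.
move=> u v /rowP e; apply/ffunP => i; apply: val_inj.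
by have := e i; rewrite !mxE => /addIr [].
Qed.

Lemma torus_projK (x : lattice d) :
  (forall i, `|(x : 'rV[int]_d) ord0 i| < 2 ^ J)%N ->
  torus_lift (torus_proj x) = x.
Proof.
move=> xJ; apply/rowP => i; rewrite !mxE ffunE.
have := xJ i; set k := (x : 'rV[int]_d) ord0 i => kJ.
have [n nE nm] : exists2 n : nat, k + (2 ^ J)%N%:Z = n%:Z & (n < m)%N.
  by exists (absz (k + (2 ^ J)%N%:Z)); rewrite ?expnS; lia.
rewrite nE -pmulrn val_Zp_nat// modn_small//.
by move: nE; lia.
Qed.

Lemma torus_projB (x : lattice d) N (g : {ffun 'I_d -> 'I_N.*2.+1}) :
  torus_proj (x - box_point g) =
  torus_proj x - [ffun i => (g i)%:R - N%:R].
Proof.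
apply/ffunP => i; rewrite !ffunE !mxE -addrA [- _ + _]addrC addrA rmorphB/=.
by rewrite rmorphB.
Qed.

End TorusLift.

Section FiniteTransference.
Variables (R : realType) (d : nat).

Lemma lattice_seq_bounded (s : seq (lattice d)) : exists X :
  nat, forall x, x \in s ->
  forall i, (`|(x : 'rV[int]_d) ord0 i| <= X)%N.
Proof.
elim: s => [|y s [X IH]]; first by exists 0%N.
exists (maxn X (\max_i `|(y : 'rV[int]_d) ord0 i|)%N) => x.
rewrite inE => /predU1P[->|xs] i; rewrite leq_max; last by rewrite IH.
by rewrite (leq_bigmax i) orbT.
Qed.

(** On a large enough torus, no average of the finitely many that matter wraps
    around. *)
Lemma box_maximal_finite (p C : R) (N : nat -> nat) (h : lattice d -> R) L
    (s : seq (lattice d)) :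
  0 < p -> cube_maximal_bound p C -> dyadic_scales N -> (forall x, 0 <= h x) ->
  uniq s -> exists J,
  \sum_(x <- s) (\big[Num.max/0]_(n < L) box_average (N n) h x) `^ p <=
    C * \sum_(u : torus d (2 ^ J.+1)) h (torus_lift u) `^ p.
Proof.
move=> p0 hC NN h0 us; have [X sX] := lattice_seq_bounded s.
pose J := (X + L).+1; exists J.
have big n (x : lattice d) (g : {ffun 'I_d -> 'I_(N n).*2.+1}) :
  (n < L)%N -> x \in s ->
    forall i : 'I_d, (absz (((x - box_point g)%R : 'rV[int]_d) ord0 i) < 2 ^ J)%N.
  move=> nL xs i; have /andP[_ Nn] := NN n.
  have NL : (N n < 2 ^ L)%N.
    by rewrite (leq_trans Nn)// leq_exp2l.
  have XX : (X < 2 ^ X)%N by exact: ltn_expl.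
  have JE : (2 ^ X + 2 ^ L <= 2 ^ J)%N.
    rewrite /J expnS expnD; have := expn_gt0 2 X; have := expn_gt0 2 L => /=.
    by set a := (2 ^ X)%N; set b := (2 ^ L)%N; nia.
  move: XX NL JE (ltn_ord (g i)) (sX x xs i); rewrite !mxE.
  move: (2 ^ X)%N (2 ^ L)%N (2 ^ J)%N => a b c.
  set k := (x : 'rV[int]_d) ord0 i; set gi : nat := g i; lia.
have small x : x \in s -> forall i, (`|(x : 'rV[int]_d) ord0 i| < 2 ^ J)%N.
  move=> xs i; apply: (leq_ltn_trans (sX x xs i)).
  by apply: (ltn_trans (ltn_expl X (ltnSn 1)));
    rewrite ltn_exp2l// /J ltnS leq_addr.
pose f (u : torus d (2 ^ J.+1)) := h (torus_lift u).
pose M u := \big[Num.max/0]_(n < J.+1) conv (cube_weight R (N n)) f u.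
apply: (@le_trans _ _ (\sum_(x <- s) M (torus_proj J x) `^ p)).
  rewrite big_seq [leRHS]big_seq; apply: ler_sum => x xs.
  apply: powR_le; first exact: ltW.
    exact: (bigmax_ge0 L (fun n => box_average (N n) h x)).
  apply: (@bigmax_leP _ L (fun n => box_average (N n) h x)) => [|n nL].
    exact: (bigmax_ge0 J.+1 (fun n =>
      conv (cube_weight R (N n)) f (torus_proj J x))).
  apply: (@le_trans _ _ (conv (cube_weight R (N n)) f (torus_proj J x))).
    rewrite conv_uniform le_eqVlt; apply/orP; left; apply/eqP.
    congr (_ / _); apply: eq_bigr => g _.
    by rewrite -torus_projB /f torus_projK// => i; exact: big.
  apply: (le_bigmax_nat (fun n => conv (cube_weight R (N n)) f (torus_proj J x))).
  by apply: (leq_trans nL); rewrite /J; lia.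
apply: (@le_trans _ _ (\sum_u M u `^ p)).
  rewrite -(big_map (torus_proj J) xpredT (fun u => M u `^ p)).
  rewrite big_uniq /=; last first.
    rewrite map_inj_in_uniq// => x y xs ys e.
    by rewrite -(torus_projK (small x xs)) e torus_projK//; exact: small.
  rewrite [leRHS](bigID (mem [seq torus_proj J x | x <- s]))/= lerDl.
  by apply: sumr_ge0 => u _; exact: powR_ge0.
by apply: hC => // u; exact: h0.
Qed.

End FiniteTransference.

(** * Integrals for the counting measure *)
Section CountingIntegral.
Variables (R : realType) (d : nat).
Local Open Scope classical_set_scope.
Local Open Scope ereal_scope.
Implicit Types k : lattice d -> \bar R.

Lemma measurable_lattice (A : set (lattice d)) : measurable A.
Proof. by []. Qed.

Lemma counting_set1 (x : lattice d) : counting [set x] = 1 :> \bar R.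
Proof.
by rewrite /counting; case: asboolP => [_|[]//]; rewrite fset_set1 cardfs1.
Qed.

(** The lattice is countable: it is the disjoint union, over the codes n, of the
    sets of points with code n, which have at most one element. *)
Lemma integral_counting_esum k : (forall x, 0 <= k x) ->
  \int[counting]_x k x = \esum_(x in [set: lattice d]) k x.
Proof.
move=> k0; pose F (n : nat) : set (lattice d) := [set x | choice.pickle (x :
  'rV[int]_d) = n].
have FT : [set: lattice d] = \bigcup_n F n.
  by apply/seteqP; split => // x _; exists (choice.pickle (x : 'rV[int]_d)).
have Ftriv : trivIset setT F.
  by move=> i j _ _ [x [/= <- <-]].
have F1 n : F n = set0 \/ exists x, F n = [set x].
  have [->|/set0P[x Fx]] := eqVneq (F n) set0; [by left|right; exists x].
  apply/seteqP; split => [y /= Fy|y -> //].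
  apply: (pcan_inj (@choice.pickleK 'rV[int]_d)); by rewrite [LHS]Fy [RHS]Fx.
rewrite FT ge0_integral_bigcup//.
rewrite nneseries_esumT => [|n]; last by apply: integral_ge0.
rewrite esum_bigcupT//; apply: eq_esum => n _.
have [->|[x ->]] := F1 n; first by rewrite integral_set0 esum_set0.
rewrite esum_set1//.
have -> : \int[counting]_(y in [set x]) k y =
  \int[counting]_(y in [set x]) cst (k x) y.
  by apply: eq_integral => y /set_mem ->.
rewrite integral_cst; last exact: measurable_lattice.
by rewrite [X in _ * X = _]counting_set1 mule1.
Qed.

Lemma sum_le_integral_counting (I : finType) (e : I -> lattice d) k :
  injective e -> (forall x, 0 <= k x) ->
  \sum_i k (e i) <= \int[counting]_x k x.
Proof.
move=> einj k0; rewrite integral_counting_esum//; apply: esum_ge.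
exists [set e i | i in [set: I]].
  by split => //; exact/finite_image/finite_finset.
rewrite fsbig_image => [|i j _ _ /einj//].
rewrite (fsbigE (index_enum I)) ?index_enum_uniq//.
  by rewrite (eq_bigl xpredT)// => g; rewrite in_setT.
by move=> g _; rewrite mem_index_enum.
Qed.

Lemma integral_counting_le k (M : \bar R) : (forall x, 0 <= k x) ->
  (forall s : seq (lattice d), uniq s -> \sum_(x <- s) k x <= M) ->
  \int[counting]_x k x <= M.
Proof.
move=> k0 kM; rewrite integral_counting_esum//.
apply: ge_ereal_sup => _ [X [finX _] <-].
by rewrite fsbig_finite//; exact/kM/fset_uniq.
Qed.

End CountingIntegral.

(** * Maximal functions on the lattice *)
Section LatticeMaximal.
Variable R : realType.
Local Open Scope classical_set_scope.
Local Open Scope ereal_scope.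

(** The supremum may a priori be infinite, hence the detour through the inverse
    power. *)
Lemma poweR_sup_le (u : nat -> R) (r : R) (A : \bar R) : (0 < r)%R ->
  (forall n, 0 <= u n)%R -> (forall n, (u n `^ r)%:E <= A) ->
  ereal_sup (range (fun n => (u n)%:E)) `^ r <= A.
Proof.
move=> r0 u0; case: A => [a||] uA; [|by rewrite leey|by have := uA 0%N].
have a0 : (0 <= a)%R by have := uA 0%N; rewrite lee_fin; apply: le_trans;
  exact: powR_ge0.
have le : ereal_sup (range (fun n => (u n)%:E)) <= (a `^ r^-1)%:E.
  apply: ge_ereal_sup => _ [n _ <-]; rewrite lee_fin.
  rewrite -[leLHS]powRr1// -(@mulfV _ r) ?gt_eqF// powRrM.
  apply: powR_le; [by rewrite invr_ge0 ltW|exact: powR_ge0|].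
  by have := uA n; rewrite lee_fin.
have ge : 0 <= ereal_sup (range (fun n => (u n)%:E)).
  by apply: (@le_trans _ _ (u 0%N)%:E);
    [rewrite lee_fin|apply: ereal_sup_ubound; exists 0%N].
move: le ge; case: (ereal_sup _) => [b||]//.
rewrite !lee_fin => ba b0.
apply: le_trans (powR_le (ltW r0) b0 ba) _.
by rewrite -powRrM mulVf ?gt_eqF// powRr1.
Qed.

Lemma le_ereal_sup_powR (u : nat -> R) (r : R) n : (0 < r)%R ->
  (forall n, 0 <= u n)%R ->
  (u n `^ r)%:E <= ereal_sup (range (fun n => (u n)%:E)) `^ r.
Proof.
move=> r0 u0; rewrite -poweR_EFin gt0_ler_poweR ?(ltW r0)// ?in_itv/= ?leey
  ?andbT ?lee_fin//.
  by apply: (@le_trans _ _ (u n)%:E);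
    [rewrite lee_fin|apply: ereal_sup_ubound; exists n].
by apply: ereal_sup_ubound; exists n.
Qed.

(** Monotone convergence in the number of averages reduces the claim to finitely
    many of them, and the integral is a supremum of finite sums. *)
Lemma box_maximal_integral d (p C : R) (N : nat -> nat) (h : lattice d -> R) :
  (0 < p)%R -> (0 <= C)%R -> cube_maximal_bound p C -> dyadic_scales N ->
  (forall x, 0 <= h x)%R ->
  \int[counting]_x (ereal_sup (range (fun n => (box_average (N n) h x)%:E)) `^ p)
    <= C%:E * \int[counting]_x ((h x `^ p)%:E).
Proof.
move=> p0 C0 hC NN h0.
pose b n x := box_average (N n) h x.
have b0 n x : (0 <= b n x)%R by exact: box_average_ge0.
pose M L x := (\big[Num.max/0%R]_(n < L) b n x)%R.
have M0 L x : (0 <= M L x)%R by exact: (bigmax_ge0 L (fun n => b n x)).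
pose g L x := (M L x `^ p)%:E.
have Mnd x : {homo (fun L => M L x) : m n / (m <= n)%N >-> (m <= n)%R}.
  move=> m n mn; apply: (@bigmax_leP _ m (fun n => b n x)) => // j jm.
  exact: (le_bigmax_nat (fun n => b n x) (leq_trans jm mn)).
have gnd x : nondecreasing_seq (g ^~ x).
  by move=> m n mn; rewrite lee_fin powR_le ?(ltW p0)//; exact: Mnd.
apply: (@le_trans _ _ (\int[counting]_x limn (g ^~ x))).
  apply: ge0_le_integral => //.
  - by move=> x _; exact: poweR_ge0.
  move=> x _; apply: poweR_sup_le => // n; first exact: b0.
  apply: (@le_trans _ _ (g n.+1 x)).
    rewrite lee_fin; apply: powR_le; [exact: ltW|exact: b0|].
    exact: (le_bigmax_nat (fun n => b n x)).
  rewrite (cvg_lim _ (ereal_nondecreasing_cvgn (gnd x)))//.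
  by apply: ereal_sup_ubound; exists n.+1.
rewrite monotone_convergence//; last by move=> n x _; rewrite lee_fin powR_ge0.
apply: lime_le.
  apply: ereal_nondecreasing_is_cvgn => m n mn.
  apply: ge0_le_integral => //.
  - by move=> x _; rewrite lee_fin powR_ge0.
  by move=> x _; exact: gnd.
apply: nearW => L; apply: integral_counting_le => [x|s us].
  by rewrite lee_fin powR_ge0.
have [J hJ] := box_maximal_finite L p0 hC NN h0 us.
rewrite sumEFin; apply: (@le_trans _ _ (C * \sum_(u :
  torus d (2 ^ J.+1)) h (torus_lift u) `^ p)%:E).
  by rewrite lee_fin.
rewrite EFinM -sumEFin lee_wpmul2l ?lee_fin//.
apply: (@sum_le_integral_counting _ _ _ (@torus_lift d J) (fun x => (h x `^ p)%:E)).
  exact: torus_lift_inj.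
by move=> x; rewrite lee_fin powR_ge0.
Qed.

End LatticeMaximal.

(** * Lacunary sequences *)
(** If m j is the first index whose value reaches 2 ^ j, the values in
    [2 ^ j, 2 ^ (j + 1)) have indices in [m j, m j + c). The i-th class takes the
    value of index m j + i, or 2 ^ j if that value lies beyond the block. *)
Lemma dyadic_classes (Nf : nat -> nat) c :
  {homo Nf : m n / (m <= n)%N} ->
  (forall n j, (2 ^ j <= Nf n)%N -> (2 ^ j.+1 <= Nf (n + c))%N) ->
  exists Ni : nat -> nat -> nat, (forall i, dyadic_scales (Ni i)) /\
    forall n, (0 < Nf n)%N -> exists i : 'I_c, exists j, Nf n = Ni i j.
Proof.
move=> Nmono Ngrow.
have /choice[m mP] : forall j, exists m, forall n,
    (2 ^ j <= Nf n < 2 ^ j.+1)%N -> (m <= n < m + c)%N.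
  move=> j.
  have [ex|nex] := pselect (exists n, 2 ^ j <= Nf n)%N; last first.
    by exists 0%N => n /andP[jn _]; case: nex; exists n.
  case: (ex_minnP ex) => m jm mmin; exists m => n /andP[jn nj].
  rewrite mmin//= ltnNge; apply/negP => mn.
  by have := leq_trans (Ngrow _ _ jm) (Nmono _ _ mn); rewrite leqNgt nj.
exists (fun i j => if (2 ^ j <= Nf (m j + i) < 2 ^ j.+1)%N
  then Nf (m j + i) else 2 ^ j)%N; split=> [i j|n n0].
  by case: ifP => //; rewrite leqnn ltn_exp2l ?ltnSn.
have b := trunc_log_bounds (isT : 1 < 2)%N n0; set j := trunc_log 2 _ in b.
have /andP[mn nm] := mP _ _ b.
have ic : (n - m j < c)%N by rewrite ltn_subLR.
by exists (Ordinal ic), j; rewrite /= subnKC// ifT.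
Qed.

Section LacunarySequences.
Variables (R : realType) (a : R) (a_ : nat -> R).
Hypotheses (a1 : 1 < a) (a0 : forall n, 0 < a_ n) (ha : lacunary_ratio a_ = a).

Lemma lacunary_growth n : a * a_ n <= a_ n.+1.
Proof.
rewrite -ler_pdivlMr// -ha; apply: ge_inf; last by exists n.
by exists 0 => _ [m _ <-]; rewrite divr_ge0// ltW.
Qed.

Lemma lacunary_growthX n k : a ^+ k * a_ n <= a_ (n + k).
Proof.
elim: k => [|k IH]; first by rewrite addn0 mul1r.
rewrite addnS exprS -mulrA (le_trans _ (lacunary_growth _))//.
by rewrite ler_wpM2l// ltW// (lt_trans ltr01).
Qed.

Lemma lacunary_classes c : 2 <= a ^+ c ->
  exists Ni : nat -> nat -> nat, (forall i, dyadic_scales (Ni i)) /\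
    forall n, (0 < Num.truncn (a_ n))%N ->
      exists i : 'I_c, exists j, Num.truncn (a_ n) = Ni i j.
Proof.
move=> ac; apply: dyadic_classes => [m n mn|n j].
  rewrite truncn_ge_nat ?(ltW (a0 _))//.
  apply: (@le_trans _ _ (a_ m)); first by rewrite truncn_le ltW.
  rewrite -(subnKC mn) (le_trans _ (lacunary_growthX _ _))// ler_peMl ?(ltW (a0
    _))//.
  by rewrite exprn_ege1// ltW.
rewrite !truncn_ge_nat ?(ltW (a0 _))// => jn.
apply: le_trans (lacunary_growthX n c); rewrite expnS natrM.
by rewrite ler_pM.
Qed.

End LacunarySequences.

Lemma exprn_ge2 (R : realType) (a : R) : 1 < a -> exists c, 2 <= a ^+ c.
Proof.
move=> a1; have b0 : 0 < a - 1 by rewrite subr_gt0.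
have bern n : 1 + n%:R * (a - 1) <= a ^+ n.
  elim: n => [|n IH]; first by rewrite mul0r addr0 expr0.
  rewrite exprS -natr1; have := ler_wpM2l (ltW (lt_trans ltr01 a1)) IH.
  have := mulr_ge0 (ler0n R n) (sqr_ge0 (a - 1)); lra.
have ib0 : 0 <= (a - 1)^-1 by rewrite invr_ge0 ltW.
exists (Num.bound (a - 1)^-1); apply: le_trans (bern _).
have := archi_boundP ib0; rewrite -[X in X < _]mul1r ltr_pdivrMr//; lra.
Qed.

(** * The norms of the maximal function *)
Section LatticeNorms.
Variables (R : realType) (d : nat).
Local Open Scope classical_set_scope.
Local Open Scope ereal_scope.
Local Notation normc := ComplexField.Normc.normc.
Implicit Type f : lattice d -> R[i].

Lemma normc_ge0 (z : R[i]) : (0 <= normc z)%R.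
Proof. by case: z => x y; exact: sqrtr_ge0. Qed.

Lemma sup_cube_averages_ge0 (a_ : nat -> R) f x : 0 <= sup_cube_averages a_ f x.
Proof.
apply: (@le_trans _ _ (cmod (cube_average (a_ 0%N) f) x)).
  by rewrite lee_fin normc_ge0.
by apply: ereal_sup_ubound; exists 0%N.
Qed.

Lemma lpnorm_EFin (p : R) (F : lattice d -> \bar R) : (forall x, 0 <= F x) ->
  lpnorm p%:E F = (\int[counting]_x (F x `^ p)) `^ p^-1.
Proof.
move=> F0; rewrite /lpnorm unlock; congr (_ `^ _).
by apply: eq_integral => x _; rewrite gee0_abs.
Qed.

(** The c classes, each with one average per dyadic scale, cover all the averages
    except those over cubes with the single lattice point 0, which are f
    itself. *)
Lemma lacunary_maximal_integral (p C : R) c (a a_ : _) f :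
  (0 < p)%R -> (0 <= C)%R -> cube_maximal_bound p C ->
  (1 < a)%R -> (2 <= a ^+ c)%R -> (forall n, 0 < a_ n)%R -> lacunary_ratio a_ = a ->
  \int[counting]_x (sup_cube_averages a_ f x `^ p) <=
    (1 + c%:R * C)%:E * \int[counting]_x (cmod f x `^ p).
Proof.
move=> p0 C0 hC a1 ac a0 ha.
have [Ni [Nid NiP]] := lacunary_classes a1 a0 ha ac.
pose h x : R := normc (f x).
have h0 x : (0 <= h x)%R by exact: normc_ge0.
pose S i x := ereal_sup (range (fun j => (box_average (Ni i j) h x)%:E)).
have b0 i j x : (0 <= box_average (Ni i j) h x)%R by exact: box_average_ge0.
apply: (@le_trans _ _ (\int[counting]_x
    ((h x `^ p)%:E + \sum_(i <- index_enum 'I_c) S i x `^ p))).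
  apply: ge0_le_integral => //.
  - by move=> x _; exact: poweR_ge0.
  move=> x _; apply: (@poweR_sup_le _ (fun n =>
    normc (cube_average (a_ n) f x))) => // n.
    exact: normc_ge0.
  apply: (@le_trans _ _ (box_average (Num.truncn (a_ n)) h x `^ p)%:E).
    rewrite lee_fin; apply: powR_le; [exact: ltW|exact: normc_ge0|].
    exact: cube_average_le.
  have S0 : 0 <= \sum_(i <- index_enum 'I_c) S i x `^ p.
    by apply: sume_ge0 => i _; exact: poweR_ge0.
  have [n0|n0] := posnP (Num.truncn (a_ n)).
    by rewrite n0 box_average0 leeDl.
  have [i [j ->]] := NiP _ n0.
  apply: (@le_trans _ _ (S i x `^ p)).
    exact: (@le_ereal_sup_powR _ (fun j => box_average (Ni i j) h x)).
  rewrite (bigD1 i)//= addeCA leeDl// adde_ge0 ?lee_fin ?powR_ge0//.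
  by apply: sume_ge0 => k _; exact: poweR_ge0.
rewrite ge0_integralD//; last 2 first.
- by move=> x _; rewrite lee_fin powR_ge0.
- by move=> x _; apply: sume_ge0 => i _; exact: poweR_ge0.
rewrite ge0_integral_sum//; last first.
- by move=> i x _; exact: poweR_ge0.
set I := \int[_]_x (h x `^ p)%:E.
have I0 : 0 <= I by apply: integral_ge0 => x _; rewrite lee_fin powR_ge0.
rewrite EFinD ge0_muleDl ?lee_fin ?mulr_ge0// mul1e leeD2l//.
apply: (@le_trans _ _ (\sum_(i <- index_enum 'I_c) (C%:E * I))).
  by apply: lee_sum => i _; exact: box_maximal_integral.
rewrite -ge0_sume_distrl => [|i _]; last by rewrite lee_fin.
by rewrite sumEFin sumr_const card_ord mulr_natl.
Qed.

Lemma ae_counting (P : lattice d -> Prop) :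
  (\forall x \ae @counting (lattice d) R, P x) -> forall x, P x.
Proof.
move=> [A [_ A0 PA]] x; apply: contrapT => Px.
have : counting [set x] <= counting A :> \bar R.
  apply: le_measure; [exact/mem_set/measurable_lattice|exact/mem_set/measurable_lattice|].
  by move=> _ ->; exact: PA.
by rewrite counting_set1 [leRHS]A0 leNgt lte01.
Qed.

Lemma maximal_ess_sup (a_ : nat -> R) f : (forall n, 0 < a_ n)%R ->
  lpnorm +oo (sup_cube_averages a_ f) <= lpnorm +oo (cmod f).
Proof.
move=> a0; rewrite /lpnorm unlock; case: ifPn => // _.
set E := ess_sup _ (abse \o cmod f).
have hE x : cmod f x <= E.
  by rewrite -[leLHS]gee0_abs ?lee_fin ?normc_ge0//;
    exact: (ae_counting (ess_sup_ge _ _)).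
apply/ess_supP; apply: nearW => x /=.
rewrite gee0_abs ?sup_cube_averages_ge0//.
apply: ge_ereal_sup => _ [n _ <-].
move: hE; case: E => [e||] hE; rewrite ?leey//; last by have := hE x.
by rewrite lee_fin (le_trans (cube_average_le _ _ (a0 n)))// box_average_le.
Qed.

End LatticeNorms.

Theorem theorem8 (R : realType) (a : R) (ha : 1 < a)
    (p : \bar R) (hp : (1 < p)%E) :
  exists C : R, 0 < C /\
    forall a_ : nat -> R, (forall n : nat, 0 < a_ n) -> lacunary_ratio a_ = a ->
    forall d : nat, (0 < d)%N ->
    forall f : lattice d -> R[i], (lpnorm p (cmod f) < +oo)%E ->
      (lpnorm p (sup_cube_averages a_ f) <= C%:E * lpnorm p (cmod f))%E.
Proof.
case: p hp => [p| |//] hp; last first.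
  exists 1; split=> // a_ a0 _ d _ f _.
  by rewrite mul1e maximal_ess_sup.
have p1 : 1 < p by rewrite -lte_fin.
have p0 : 0 < p by rewrite (lt_trans ltr01).
have [C C0 hC] := cube_maximal p1.
have [c ac] := exprn_ge2 ha.
have K0 : 0 < 1 + c%:R * C by rewrite ltr_wpDr// mulr_ge0.
exists ((1 + c%:R * C) `^ p^-1); split; first exact: powR_gt0.
move=> a_ a0 aa d _ f _.
have cf0 x : (0 <= cmod f x)%E by rewrite lee_fin normc_ge0.
rewrite !lpnorm_EFin//; last by move=> x; exact: sup_cube_averages_ge0.
rewrite -poweR_EFin -poweRM ?lee_fin ?(ltW K0)//; last first.
  by apply: integral_ge0 => x _; exact: poweR_ge0.
have I0 : (0 <= \int[counting]_x (cmod f x `^ p))%E.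
  by apply: integral_ge0 => x _; exact: poweR_ge0.
apply: gt0_ler_poweR; rewrite ?invr_ge0 ?(ltW p0)// ?in_itv/= ?leey ?andbT.
- by apply: integral_ge0 => x _; exact: poweR_ge0.
- by rewrite mule_ge0// lee_fin ltW.
- exact: (lacunary_maximal_integral _ p0 C0 hC ha ac a0 aa).
Qed.
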